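(* Let $D$ be a divisor of the algebraic function field $F/k$ with ideal representation $(I,I_\infty)$, let $\|\cdot\|=\|\cdot\|_D$ be the associated norm on $F$, and let $r\in\mathbb{Z}$. Then: (1) $\mathcal{L}(D+r(t)_\infty)=I\cap t^rI_\infty=(I,\|\cdot\|)_{\le r}$. (2) $(I,\|\cdot\|)$ is a lattice over $k[t]$, and $(F,\|\cdot\|)$ is a normed space over $k(t)$.
   Context: Let $k$ be a field, $A=k[t]$, $K=k(t)$, with degree function $|a/b|=\deg a-\deg b$ for nonzero $a,b\in A$, $|0|=-\infty$; $A_\infty=\{x\in K:|x|\le0\}$ with maximal ideal $P_\infty$. Let $F/k$ be an algebraic function field of one variable, where $F/K$ is a separable extension of finite degree $n$. $\mathbb{P}_F$ is the set of places of $F/k$, with surjective valuations $v_P:F\to\mathbb{Z}\cup\{\infty\}$; $\mathbb{P}_\infty(F)$ is the set of places over $P_\infty$ and $\mathbb{P}_0(F)=\mathbb{P}_F\setminus\mathbb{P}_\infty(F)$; $e(P/P_\infty)$ is the ramification index. For a divisor $D$, $v_P(D)$ is its coefficient at $P$ and $\mathcal{L}(D)=\{a\in F^*:v_P(a)\ge -v_P(D)\ \forall P\in\mathbb{P}_F\}\cup\{0\}$. Put $(t)_\infty=\sum_{P\in\mathbb{P}_\infty(F)}e(P/P_\infty)\,P$. Let $\mathcal{O}_F$ and $\mathcal{O}_{F,\infty}$ be the integral closures of $A$ and $A_\infty$ in $F$; their nonzero primes correspond to the finite, respectively infinite, places of $F$, the prime $\mathfrak{p}_P$ corresponding to $P$.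 The ideal representation of $D$ is the pair $(I,I_\infty)$ with $I=\prod_{P\in\mathbb{P}_0(F)}\mathfrak{p}_P^{-v_P(D)}$ (a fractional ideal of $\mathcal{O}_F$) and $I_\infty=\prod_{P\in\mathbb{P}_\infty(F)}\mathfrak{p}_P^{-v_P(D)}$ (a fractional ideal of $\mathcal{O}_{F,\infty}$). The norm is $$\|z\|_D=-\min_{P\in\mathbb{P}_\infty(F)}\frac{v_P(z)+v_P(D)}{e(P/P_\infty)}.$$ A norm on an $A$-module or $K$-vector space $L$ is a map $\|\cdot\|:L\to\{-\infty\}\cup\mathbb{R}$ with $\|x+y\|\le\max\{\|x\|,\|y\|\}$, $\|ax\|=|a|+\|x\|$ for scalars $a$, and $\|x\|=-\infty$ iff $x=0$; $(L,\|\cdot\|)_{\le r}=\{x\in L:\|x\|\le r\}$. A lattice over $A$ is a finitely generated $A$-module with a norm such that $\dim_kL_{\le r}<\infty$ for all $r\in\mathbb{R}$. A normed space over $K$ is a finite-dimensional $K$-vector space with a norm admitting a finitely generated $A$-submodule of full rank which is a lattice with the restricted norm. *)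

(* Defs.v *)
From HB Require Import structures.
From mathcomp Require Import all_boot all_order all_algebra all_field.
From mathcomp Require Import all_classical all_reals.

Set Implicit Arguments.
Unset Strict Implicit.
Unset Printing Implicit Defensive.

Import Order.TTheory GRing.Theory Num.Theory.

Local Open Scope classical_set_scope.
Local Open Scope ring_scope.

Notation ratfun k := {fraction {poly k}}.

Definition ext_intr (R : realType) : \bar int -> \bar R :=
  er_map (fun m : int => m%:~R : R).

Section RationalFunctions.
Variable k : fieldType.
Implicit Types x : ratfun k.

(* [repr x] is a numerator/denominator pair; the difference of degrees is the
   same for all of them, and [size] is degree + 1. *)
Definition rdeg x : \bar int :=
  if x == 0 then -oo%E
  else ((size \n_(repr x))%:Z - (size \d_(repr x))%:Z)%:E.

Definition consts : set (ratfun k) := [set x | exists c : k, x = tofrac c%:P].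
Definition polys : set (ratfun k) := [set x | exists a : {poly k}, x = tofrac a].
Definition A_infty : set (ratfun k) := [set x | (rdeg x <= 0)%E].
Definition P_infty : set (ratfun k) := [set x | (rdeg x < 0)%E].

End RationalFunctions.
Arguments consts {k}.
Arguments polys {k}.
Arguments A_infty {k}.
Arguments P_infty {k}.

Section Places.
Variables (k : fieldType) (F : fieldExtType (ratfun k)).

Definition is_place (v : F -> \bar int) : Prop :=
  [/\ forall x, v x = +oo%E <-> x = 0,
      forall x y, v (x * y) = (v x + v y)%E,
      forall x y, (Order.min (v x) (v y) <= v (x + y)%R)%E,
      forall c : k, c != 0 -> v (tofrac c%:P)%:A = 0%E
    & range v = [set m | m <> -oo%E]].

(* A place is represented by its surjective valuation, trivial on k; distinct
   places have distinct valuations. *)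
Record place := Place {
  val_at :> F -> \bar int;
  val_atP : is_place val_at }.

HB.instance Definition _ := gen_eqMixin place.
HB.instance Definition _ := gen_choiceMixin place.

Implicit Type P : place.

Definition infinite_places : set place :=
  [set P | [set x : ratfun k | (0 < P x%:A)%E] = P_infty].
Definition finite_places : set place := ~` infinite_places.

(* The ramification index of P over P_infty: the integer e such that
   v_P = e * v_infty on k(t), where v_infty x = - |x|.  It is only used for
   P in [infinite_places], where it exists, is unique and is positive. *)
Definition ram_index P : nat :=
  xget 0%N [set e | forall x : ratfun k, P x%:A = (e%:Z%:E * - rdeg x)%E].

(* The group operations on divisors are pointwise; the definitions below make
   sense for any function, finitely supported or not. *)
Definition divisor (D : place -> int) : Prop :=
  finite_set [set P | D P != 0].

Definition t_infty P : int :=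
  if P \in infinite_places then (ram_index P)%:Z else 0.

Definition RRspace (D : place -> int) : set F :=
  [set a | a = 0 \/ forall P, ((- D P)%:E <= P a)%E].

Definition int_closure (S : set (ratfun k)) : set F :=
  [set x | exists p : {poly ratfun k},
    [/\ p \is monic, forall i, S p`_i & root (map_poly (in_alg F) p) x]].

(* Fractional ideals of a subring [O] of F, as subsets of F. *)
Definition ideal_mul (I J : set F) : set F :=
  [set z | exists s : seq (F * F),
    (forall u, u \in s -> I u.1 /\ J u.2) /\ z = \sum_(u <- s) u.1 * u.2].

Definition ideal_inv (O I : set F) : set F :=
  [set x | forall y, I y -> O (x * y)].

Definition ideal_exp (O I : set F) (m : int) : set F :=
  match m with
  | Posz n => iter n (ideal_mul I) O
  | Negz n => iter n.+1 (ideal_mul (ideal_inv O I)) O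
  end.

Definition prime_at (O : set F) P : set F :=
  O `&` [set x | (0 < P x)%E].

Definition ideal_of (O : set F) (places : set place) (D : place -> int) :=
  \big[ideal_mul/O]_(P \in places) ideal_exp O (prime_at O P) (- D P).

Definition fin_ideal (D : place -> int) : set F :=
  ideal_of (int_closure polys) finite_places D.

Definition inf_ideal (D : place -> int) : set F :=
  ideal_of (int_closure A_infty) infinite_places D.

Definition t_elt : F := (tofrac ('X : {poly k}))%:A.

(* [infinite_places] is finite and nonempty, so this is a genuine minimum;
   v_P 0 = +oo gives 0 the norm -oo. *)
Definition div_norm (R : realType) (D : place -> int) (z : F) : \bar R :=
  (- \big[Order.min/+oo]_(P \in infinite_places)
       ((ext_intr R (P z) + (D P)%:~R%:E) * ((ram_index P)%:R^-1)%:E))%E.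

End Places.

(* Lattices are taken inside a vector space over k(t), where all modules of
   interest live; [S] is a set of scalars (k, k[t] or k(t) itself). *)
Section Lattices.
Variables (k : fieldType) (R : realType).

Definition span_over (V : lmodType (ratfun k)) (S : set (ratfun k))
    (s : seq V) : set V :=
  [set x | exists c : nat -> ratfun k,
    (forall i, S (c i)) /\ x = \sum_(i < size s) c i *: s`_i].

(* For S = k this says that L is a finite-dimensional k-subspace, for
   S = k[t] that L is a finitely generated k[t]-submodule. *)
Definition fin_gen (V : lmodType (ratfun k)) (S : set (ratfun k))
    (L : set V) : Prop :=
  exists s : seq V, L = span_over S s.

Definition is_norm (V : lmodType (ratfun k)) (S : set (ratfun k))
    (L : set V) (N : V -> \bar R) : Prop :=
  [/\ forall x, L x -> N x <> +oo%E,
      forall x y, L x -> L y -> (N (x + y)%R <= Order.max (N x) (N y))%E,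
      forall a x, S a -> L x -> N (a *: x) = (ext_intr R (rdeg a) + N x)%E
    & forall x, L x -> (N x = -oo%E <-> x = 0)].

Definition le_part (V : lmodType (ratfun k)) (L : set V) (N : V -> \bar R)
    (r : R) : set V := [set x | L x /\ (N x <= r%:E)%E].

Definition lattice (V : lmodType (ratfun k)) (L : set V)
    (N : V -> \bar R) : Prop :=
  [/\ fin_gen polys L, is_norm polys L N
    & forall r : R, fin_gen consts (le_part L N r)].

Definition full_rank (V : vectType (ratfun k)) (L : set V) : Prop :=
  exists b : seq V, basis_of fullv b /\ (forall x, x \in b -> L x).

Definition normed_space (V : vectType (ratfun k)) (N : V -> \bar R) : Prop :=
  is_norm setT setT N /\ exists L : set V, full_rank L /\ lattice L N.

End Lattices.

(* Main.v *)
Require Import Defs.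
From HB Require Import structures.
From mathcomp Require Import all_boot all_order all_algebra all_field.
From mathcomp Require Import all_classical all_reals.
From mathcomp Require Import zify ring.

Set Implicit Arguments.
Unset Strict Implicit.
Unset Printing Implicit Defensive.

Import Order.TTheory GRing.Theory Num.Theory.

Local Open Scope classical_set_scope.
Local Open Scope ring_scope.

(**
Everything is read off from valuations.  The heart of the matter is that the
products of prime powers I and I_infty, formed in the rings O_F and
O_(F,infty), are cut out by inequalities between valuations:
I = {x | v_P x >= - v_P D for all finite P}, and likewise for I_infty and the
infinite places ([ideal_ofE]).  As v_P t = - e(P/P_infty) at an infinite place,
both equalities of part (1) then compare the same inequalities.

Two facts give the description of the ideals.
- An element x that is not integral over a subring A containing k has a pole at
  some place that is nonnegative on A ([place_exists]).  A subring of F that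
  contains A and 1/x and is maximal among those omitting x is a valuation ring;
  it is discrete because it is so on k(t), and because 1, x, ..., x ^+ n are
  linearly dependent over k(t) for n = [F : k(t)].  Applied to k[t] and to
  A_infty, this identifies O_F and O_(F,infty) with intersections of valuation
  rings.
- Places can be approximated independently ([weak_approximation]); on the finite
  places an element with prescribed behaviour at finitely many of them can
  moreover be kept integral at all others, by the Chinese remainder theorem in
  k[t] ([strong_approximation_fin]).  This makes the fractional ideals cut out by
  a and by - a inverse to each other ([vset_mul]).

For part (2), let W_m be the space of all x without finite poles and with
v_P x >= - m e(P/P_infty) at the infinite places.  A k(t)-linear relation
between n + 1 elements of W_m can be scaled to have coefficients in A_infty that
are not all in P_infty, and modulo P_infty such coefficients are constants: so
n + 1 elements of W_m are dependent over k modulo W_(m - 1)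
([bounded_poles_step]).  Moreover W_(-1) = 0, since an element without poles is
algebraic over k and has no zeros unless it vanishes ([no_poles_eq0]).  Hence
every W_m has finite dimension, and multiplication by a polynomial embeds the
elements of I of bounded norm into some W_m.  Finally, subtracting from an
element of I its polynomial parts with respect to a k(t)-basis contained in I
leaves an element of I of bounded norm, so that I is finitely generated over
k[t] ([fin_ideal_fin_gen]).
*)

(** * Places as normalised discrete valuations *)

Section Valuations.
Variables (k : fieldType) (F : fieldExtType (ratfun k)).
Implicit Types (P Q : place F) (x y z : F) (m n : int).

Lemma alg_eq0 (c : ratfun k) : ((c%:A : F) == 0) = (c == 0).
Proof. by rewrite scaler_eq0 oner_eq0 orbF. Qed.

Lemma algM (c d : ratfun k) : (c * d)%:A = c%:A * d%:A :> F.
Proof. exact: (rmorphM (in_alg F)). Qed.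

Lemma algV (c : ratfun k) : (c^-1)%:A = (c%:A)^-1 :> F.
Proof. exact: (fmorphV (in_alg F)). Qed.

(** The value 0 at x = 0 is a default; lower bounds are stated with [vge], for
    which 0 has infinite valuation. *)
Definition vint P x : int := if P x is m%:E then m else 0.

Definition vge P m : set F := [set x | (m%:E <= P x)%E].

Lemma val_eqy P x : P x = +oo%E <-> x = 0.
Proof. by case: (val_atP P). Qed.

Lemma valM P x y : P (x * y) = (P x + P y)%E.
Proof. by case: (val_atP P). Qed.

Lemma valE P x : x != 0 -> P x = (vint P x)%:E.
Proof.
move=> x0; rewrite /vint; case E : (P x) => [m||] //.
  by case/negP: x0; apply/eqP/(val_eqy P).
case: (val_atP P) => _ _ _ _ rangeP.
have : range P (P x) by exists x.
by rewrite rangeP E.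
Qed.

Lemma val0 P : P 0 = +oo%E.
Proof. exact/val_eqy. Qed.

Lemma vgeE P m x : x != 0 -> vge P m x = (m <= vint P x) :> Prop.
Proof. by move=> x0; rewrite /vge /= valE // lee_fin. Qed.

Lemma vge0 P m : vge P m 0.
Proof. by rewrite /vge /= val0 leey. Qed.

Lemma vge_vint P x : vge P (vint P x) x.
Proof. by have [->|x0] := eqVneq x 0; [exact: vge0 | rewrite vgeE]. Qed.

Lemma vgeW P m n x : m <= n -> vge P n x -> vge P m x.
Proof. by move=> mn; apply: le_trans; rewrite lee_fin. Qed.

Lemma vgeD P m x y : vge P m x -> vge P m y -> vge P m (x + y).
Proof.
case: (val_atP P) => _ _ + _ _ => /(_ x y) + xm ym; apply: le_trans.
by rewrite le_min; apply/andP.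
Qed.

Lemma vge_sum P m I (r : seq I) (p : pred I) (f : I -> F) :
  (forall i, p i -> vge P m (f i)) -> vge P m (\sum_(i <- r | p i) f i).
Proof. by move=> fm; apply: big_ind => //; [exact: vge0 | exact: vgeD]. Qed.

Lemma vintM P x y : x != 0 -> y != 0 -> vint P (x * y) = vint P x + vint P y.
Proof.
move=> x0 y0; have := valM P x y.
by rewrite !valE ?mulf_neq0 // -EFinD => -[].
Qed.

Lemma vint1 P : vint P 1 = 0.
Proof.
by have := @vintM P 1 1 (oner_neq0 _) (oner_neq0 _); rewrite mulr1; lia.
Qed.

Lemma vintX P x j : x != 0 -> vint P (x ^+ j) = vint P x * j%:Z.
Proof.
move=> x0; elim: j => [|j IH]; first by rewrite vint1 mulr0.
by rewrite exprS vintM ?expf_neq0 // IH; lia.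
Qed.

Lemma vintV P x : x != 0 -> vint P x^-1 = - vint P x.
Proof.
move=> x0; have := @vintM P x x^-1 x0; rewrite invr_eq0 => /(_ x0).
by rewrite mulfV // vint1; lia.
Qed.

Lemma vintXz P x m : x != 0 -> vint P (x ^ m) = vint P x * m.
Proof.
move=> x0; case: m => j; first exact: vintX.
by rewrite NegzE -exprnN vintV ?expf_neq0 // vintX //; lia.
Qed.

Lemma vintN1 P : vint P (-1) = 0.
Proof.
have := @vintM P (-1) (-1); rewrite oppr_eq0 oner_eq0 mulrNN mulr1 vint1.
by move=> /(_ isT isT); lia.
Qed.

Lemma vintN P x : vint P (- x) = vint P x.
Proof.
have [->|x0] := eqVneq x 0; first by rewrite oppr0.
by rewrite -mulN1r vintM ?oppr_eq0 ?oner_eq0 // vintN1 add0r.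
Qed.

Lemma vgeN P m x : vge P m x -> vge P m (- x).
Proof.
have [->|x0] := eqVneq x 0; first by rewrite oppr0.
by rewrite !vgeE ?oppr_eq0 // vintN.
Qed.

Lemma vgeB P m x y : vge P m x -> vge P m y -> vge P m (x - y).
Proof. by move=> xm ym; apply: vgeD => //; exact: vgeN. Qed.

Lemma vgeM P m n x y : vge P m x -> vge P n y -> vge P (m + n) (x * y).
Proof.
have [->|x0] := eqVneq x 0; first by rewrite mul0r => *; exact: vge0.
have [->|y0] := eqVneq y 0; first by rewrite mulr0 => *; exact: vge0.
by rewrite !vgeE ?mulf_neq0 // vintM //; lia.
Qed.

Lemma vge0M P x y : vge P 0 x -> vge P 0 y -> vge P 0 (x * y).
Proof. exact: vgeM. Qed.

Lemma vge0X P x j : vge P 0 x -> vge P 0 (x ^+ j).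
Proof.
move=> xP; elim: j => [|j IH]; last by rewrite exprS; exact: vge0M.
by rewrite vgeE ?oner_neq0 // vint1.
Qed.

(** Otherwise x = (x + y) - y would have a larger valuation than x. *)
Lemma vint_dom P x y : x != 0 -> vge P (vint P x + 1) y ->
  x + y != 0 /\ vint P (x + y) = vint P x.
Proof.
move=> x0 yx.
have xy0 : x + y != 0.
  apply/eqP => /eqP; rewrite addr_eq0 => /eqP xN.
  have := vgeN yx; rewrite -xN vgeE //; lia.
split=> //; apply/eqP; rewrite eq_le; apply/andP; split.
  rewrite leNgt; apply/negP => lt.
  have : vge P (vint P x + 1) (x + y - y).
    by apply: vgeB => //; rewrite vgeE //; lia.
  by rewrite addrK vgeE //; lia.
rewrite -(vgeE P _ xy0); apply: vgeD; first exact: vge_vint.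
by apply: vgeW yx; lia.
Qed.

Lemma vint_const P (c : k) : vint P (tofrac c%:P)%:A = 0.
Proof.
have [->|c0] := eqVneq c 0; last first.
  by case: (val_atP P) => _ _ _ /(_ c c0) + _; rewrite /vint => ->.
by rewrite polyC0 rmorph0 scale0r /vint val0.
Qed.

Lemma vge_const P (c : k) : vge P 0 (tofrac c%:P)%:A.
Proof. by rewrite -(vint_const P c); exact: vge_vint. Qed.

Lemma val_surj P m : exists2 x, x != 0 & vint P x = m.
Proof.
case: (val_atP P) => _ _ _ _ rangeP.
have : range P m%:E by rewrite rangeP.
case=> x _ xm; exists x; last by rewrite /vint xm.
by apply/eqP => x0; move: xm; rewrite x0 val0.
Qed.

Lemma place_eq P Q : (forall x, P x = Q x) -> P = Q.
Proof.
case: P => v Pv; case: Q => w Pw /= vw.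
have {}vw : v = w by exact/funext.
by case: _ / vw Pw => Pw; rewrite (Prop_irrelevance Pv Pw).
Qed.

(** The valuation ring determines the normalised valuation: units of P are
    units of Q, so v_Q is a multiple of v_P, and both are onto. *)
Lemma place_incl P Q : (forall x, vge P 0 x -> vge Q 0 x) -> P = Q.
Proof.
move=> PQ.
have unitQ x : x != 0 -> vint P x = 0 -> vint Q x = 0.
  move=> x0 xP; have := PQ x; have := PQ x^-1.
  rewrite !vgeE ?invr_eq0 // !vintV // xP; lia.
have [p p0 pP] := val_surj P 1.
have e_ge0 : 0 <= vint Q p by have := PQ p; rewrite !vgeE // pP; apply.
have QP x : x != 0 -> vint Q x = vint P x * vint Q p.
  move=> x0.
  have u0 : x * p ^ (- vint P x) != 0 by rewrite mulf_neq0 ?expfz_neq0.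
  have := unitQ _ u0; rewrite !vintM ?expfz_neq0 // !vintXz // pP; lia.
have [q q0 qQ] := val_surj Q 1.
have e1 : vint Q p = 1.
  have := QP q q0; rewrite qQ; move: e_ge0; case: (lerP (vint P q) 0) => ?.
    by nia.
  by nia.
apply: place_eq => x; have [->|x0] := eqVneq x 0; first by rewrite !val0.
by rewrite !valE // QP // e1 mulr1.
Qed.

End Valuations.
Arguments alg_eq0 {k} F c.

(** * Weak approximation *)

Section Approximation.
Variables (k : fieldType) (F : fieldExtType (ratfun k)).
Implicit Types (P Q : place F) (s : seq (place F)) (x y z : F) (m n : int).

Lemma place_separate2 P Q : P <> Q ->
  exists z, [/\ z != 0, 0 < vint P z & vint Q z < 0].
Proof.
have half P' Q' : P' <> Q' -> exists x, [/\ x != 0, 0 <= vint P' x & vint Q' x < 0].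
  move=> PQ; apply: contrapT => nx; apply: PQ; apply: place_incl => x Px.
  have [->|x0] := eqVneq x 0; first exact: vge0.
  rewrite vgeE // leNgt; apply/negP => Qx; apply: nx; exists x; split => //.
  by rewrite -(vgeE _ _ x0).
move=> PQ; have [x [x0 xP xQ]] := half _ _ PQ.
have [y [y0 yQ yP]] := half _ _ (nesym PQ).
exists (x / y); rewrite mulf_neq0 ?invr_eq0 //.
by rewrite !vintM ?invr_eq0 // !vintV //; split => //; lia.
Qed.

(** In the induction, a high power of y is added to z: its valuations on s differ
    from those of z, so that no cancellation can occur there. *)
Lemma place_separate P s : P \notin s ->
  exists z, [/\ z != 0, 0 < vint P z & forall Q, Q \in s -> vint Q z < 0].
Proof.
elim: s => [_|Q s IH].
  by have [z z0 zP] := val_surj P 1; exists z; split => //; rewrite zP.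
rewrite inE negb_or => /andP[/eqP PQ /IH[z [z0 zP zs]]].
have [y [y0 yP yQ]] := place_separate2 PQ.
have [zQ|zQ] := ltrP (vint Q z) 0.
  by exists z; split => // Q'; rewrite inE => /predU1P[->//|/zs].
(* r exceeds all valuations of z on s, so that y ^+ r and z never agree there *)
pose r := (\sum_(Q' <- s) `|vint Q' z|%N).+1.
have r_gt0 : (0 < r)%N by [].
have ltr Q' : Q' \in s -> (`|vint Q' z| < r)%N.
  by move=> Q's; rewrite /r (big_rem Q') //=; lia.
have yr0 : y ^+ r != 0 by rewrite expf_neq0.
clearbody r.
have zyP : vge P 1 (z + y ^+ r).
  apply: vgeD; rewrite vgeE // ?vintX //; nia.
have neg Q' : Q' \in Q :: s -> z + y ^+ r != 0 /\ vint Q' (z + y ^+ r) < 0.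
  rewrite inE => /predU1P[->|Q's].
    have := @vint_dom _ _ Q (y ^+ r) z yr0; rewrite vgeE // [y ^+ r + z]addrC vintX //.
    by case=> [|-> ->]; [nia | split => //; nia].
  have zlt := zs _ Q's; have := ltr _ Q's.
  case: (ltrgtP (vint Q' (y ^+ r)) (vint Q' z)) => [lt|gt|]; last first.
  - by rewrite vintX //; case: (ltrP (vint Q' y) 0) => ?; nia.
  - by have [|-> ->] := @vint_dom _ _ Q' z (y ^+ r) z0; rewrite ?vgeE //; lia.
  - have [|] := @vint_dom _ _ Q' (y ^+ r) z yr0; first by rewrite vgeE //; lia.
    by rewrite addrC => -> ->; split => //; lia.
have [|zy0 _] := neg Q; first by rewrite inE eqxx.
exists (z + y ^+ r); split => // [|Q' /neg[]//].
by move: zyP; rewrite vgeE //; lia.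
Qed.

(** An element close to 1 at P and close to 0 on s is 1 / (1 + z ^+ M.+1), for
    z with a zero at P and poles on s. *)
Lemma place_indicator P s (M : nat) : P \notin s ->
  exists w, vge P M%:Z (w - 1) /\ forall Q, Q \in s -> vge Q M%:Z w.
Proof.
move=> /place_separate[z [z0 zP zs]].
have zM0 : z ^+ M.+1 != 0 by rewrite expf_neq0.
have [d0 dP] : 1 + z ^+ M.+1 != 0 /\ vint P (1 + z ^+ M.+1) = vint P 1.
  by apply: vint_dom; rewrite ?oner_neq0 // vgeE // vint1 vintX //; nia.
exists (1 + z ^+ M.+1)^-1; split => [|Q Qs].
  have -> : (1 + z ^+ M.+1)^-1 - 1 = - (z ^+ M.+1 / (1 + z ^+ M.+1)) by field.
  apply: vgeN; rewrite vgeE ?mulf_neq0 ?invr_eq0 // vintM ?invr_eq0 //.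
  by rewrite vintV // dP vint1 vintX //; nia.
rewrite vgeE ?invr_eq0 // vintV //.
have zQ := zs _ Qs.
have [] := @vint_dom _ _ Q (z ^+ M.+1) 1 zM0.
  by rewrite vgeE ?oner_neq0 // vint1 vintX //; nia.
by rewrite addrC => _ ->; rewrite vintX //; nia.
Qed.

(** The sum over s of x P times an indicator of P, the precision of the indicators
    making up for the poles of the x P. *)
Lemma weak_approximation s (x : place F -> F) m : uniq s ->
  exists w, forall P, P \in s -> vge P m (w - x P).
Proof.
move=> us.
have local P : exists y, P \in s -> vge P m (y - x P) /\
    forall Q, Q \in s -> Q != P -> vge Q m y.
  have [Ps|] := boolP (P \in s); last by exists 0.
  have [x0|x0] := eqVneq (x P) 0.
    by exists 0 => _; rewrite x0 subrr; split => [|? ? ?]; exact: vge0.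
  pose M := (`|m| + \sum_(Q <- s) `|vint Q (x P)|)%N.
  have leM Q : Q \in s -> (`|m| + `|vint Q (x P)| <= M)%N.
    by move=> Qs; rewrite /M (big_rem Q) //=; lia.
  have [|w [wP ws]] := @place_indicator P [seq Q <- s | Q != P] M.
    by rewrite mem_filter eqxx.
  have close Q u : Q \in s -> vge Q M%:Z u -> vge Q m (u * x P).
    move=> /leM Qs uM; apply: (@vgeW _ _ _ _ (M%:Z + vint Q (x P))); first lia.
    by apply: vgeM => //; exact: vge_vint.
  exists (w * x P) => _; split => [|Q Qs QP].
    by rewrite -{2}[x P]mul1r -mulrBl; exact: close.
  by apply: close => //; apply: ws; rewrite mem_filter QP.
have [y yP] := choice local.
exists (\sum_(P <- s) y P) => P Ps.
rewrite (big_rem P) //= addrAC; apply: vgeD; first by case: (yP P Ps).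
rewrite big_seq; apply: vge_sum => Q; rewrite (rem_filter _ us) mem_filter /=.
by case/andP => QP Qs; apply: (yP Q Qs).2 => //; rewrite eq_sym.
Qed.

Lemma linear_dependence N (y : 'I_N -> F) : (\dim {:F} < N)%N ->
  exists c : 'I_N -> ratfun k,
    (exists i, ((c i)%:A : F) != 0) /\ \sum_i c i *: y i = 0.
Proof.
move=> dimN; have nfree : ~~ free (mktuple y).
  apply/negP => /eqnP; rewrite size_tuple => dimy.
  by have := dimvS (subvf <<mktuple y>>%VS); rewrite dimy leqNgt dimN.
apply: contrapT => nc; case/negP: nfree; apply/freeP => c c0 i.
apply/eqP; rewrite -(alg_eq0 F); apply/negPn/negP => ci.
apply: nc; exists c; split; first by exists i.
by rewrite -[RHS]c0; apply: eq_bigr => j _; rewrite (nth_mktuple y).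
Qed.

(** The relation is divided by its coefficient of least valuation at P. *)
Lemma scaled_linear_dependence P N (y : 'I_N -> F) : (\dim {:F} < N)%N ->
  exists c : 'I_N -> ratfun k,
    [/\ forall j, vge P 0 (c j)%:A, exists i, ((c i)%:A : F) = 1
      & \sum_j (c j)%:A * y j = 0].
Proof.
move=> dimN; have [c [[i0 ci0] cy]] := linear_dependence y dimN.
pose v i := vint P (c i)%:A.
have [i ci imin] : exists2 i, ((c i)%:A : F) != 0 &
    forall j, ((c j)%:A : F) != 0 -> v i <= v j.
  pose p i := ((c i)%:A : F) != 0.
  by case: (@arg_minP _ _ 'I_N i0 p v ci0) => i ci imin; exists i.
exists (fun j => c j / c i); split.
- move=> j; rewrite algM algV.
  have [->|cj] := eqVneq ((c j)%:A : F) 0; first by rewrite mul0r; exact: vge0.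
  rewrite vgeE ?mulf_neq0 ?invr_eq0 // vintM ?invr_eq0 // vintV //.
  by rewrite subr_ge0 imin.
- by exists i; rewrite algM algV mulfV.
transitivity (((c i)%:A)^-1 * \sum_j c j *: y j); last by rewrite cy mulr0.
rewrite mulr_sumr; apply: eq_bigr => j _.
by rewrite algM algV -[c j *: y j]mulr_algl mulrA [_^-1 * _]mulrC.
Qed.

(** Elements y_P that are units at P and vanish at the other places of s are
    linearly independent over k(t): a relation between them can be scaled to have
    coefficients integral at these places, one of them being 1. *)
Lemma equivalent_places_bound s : uniq s ->
  (forall P Q (c : ratfun k), P \in s -> Q \in s ->
     vge P 0 c%:A -> vge Q 0 c%:A) ->
  (size s <= \dim {:F})%N.
Proof.
move=> us eqs; rewrite leqNgt; apply/negP => dims.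
have [P0 P0s] : exists P0, P0 \in s.
  by case: (s) dims => // P0 s' _; exists P0; rewrite inE eqxx.
pose place_of (i : 'I_(size s)) := nth P0 s i.
have place_of_s i : place_of i \in s by exact: mem_nth.
have unit_at (i : 'I_(size s)) : exists y, vge (place_of i) 1 (y - 1) /\
    forall j, j != i -> vge (place_of j) 1 y.
  have [|w [wP ws]] := @place_indicator (place_of i) (rem (place_of i) s) 1.
    by rewrite mem_rem_uniqF.
  exists w; split => // j ji; apply: ws.
  rewrite rem_filter // mem_filter place_of_s andbT /=.
  by rewrite (nth_uniq P0) ?ltn_ord.
have [y yP] := choice unit_at.
have [c [cP0 [i ci] cy]] := scaled_linear_dependence P0 y dims.
have integral j : vge (place_of i) 0 (c j)%:A.
  exact: (eqs P0 (place_of i) _ P0s (place_of_s i) (cP0 j)).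
move: cy; rewrite (bigD1 i) //= ci mul1r => sum0.
have : vge (place_of i) 1 (1 : F).
  have -> : 1 = - (y i - 1) - \sum_(j < size s | j != i) (c j)%:A * y j.
    by rewrite opprB -addrA -opprD sum0 subr0.
  apply: vgeB; first by apply: vgeN; case: (yP i).
apply: vge_sum => j ji; rewrite -[X in vge _ X](add0r 1).
  by apply: (vgeM (integral j)); apply: (yP j).2; rewrite eq_sym.
by rewrite vgeE ?oner_neq0 // vint1.
Qed.

End Approximation.

(** * Valuation rings omitting a non-integral element *)

Section ValuationSubrings.
Variable L : fieldType.
Implicit Types (A B : set L) (x y z : L) (p q : {poly L}).

Definition subring A := [/\ A 1, forall x y, A x -> A y -> A (x - y)
  & forall x y, A x -> A y -> A (x * y)].

Definition coefs_in A p := forall i, A p`_i.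

Definition integral A x := exists p, [/\ p \is monic, coefs_in A p & root p x].

Definition adjoin A y : set L := [set x | exists2 p, coefs_in A p & x = p.[y]].

Definition valuation_subring B := subring B /\ forall x, B x \/ B x^-1.

Section SubringTheory.
Variables (A : set L) (subA : subring A).

Lemma subring1 : A 1. Proof. by case: subA. Qed.

Lemma subringB x y : A x -> A y -> A (x - y).
Proof. by case: subA => _ + _; exact. Qed.

Lemma subringM x y : A x -> A y -> A (x * y).
Proof. by case: subA => _ _; exact. Qed.

Lemma subring0 : A 0.
Proof. by rewrite -(subrr 1); apply: subringB; exact: subring1. Qed.

Lemma subringN x : A x -> A (- x).
Proof. by rewrite -sub0r => xA; apply: subringB => //; exact: subring0. Qed.

Lemma subringD x y : A x -> A y -> A (x + y).
Proof. by move=> xA yA; rewrite -[y]opprK; apply: subringB => //; exact: subringN. Qed.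

Lemma subringX x n : A x -> A (x ^+ n).
Proof.
by move=> xA; elim: n => [|n IH]; [exact: subring1 | rewrite exprS; exact: subringM].
Qed.

Lemma subring_sum I (r : seq I) (P : pred I) (f : I -> L) :
  (forall i, P i -> A (f i)) -> A (\sum_(i <- r | P i) f i).
Proof. by move=> fA; apply: big_ind => //; [exact: subring0 | exact: subringD]. Qed.

Lemma coefs_inC x : A x -> coefs_in A x%:P.
Proof. by move=> xA i; rewrite coefC; case: eqP => // _; exact: subring0. Qed.

Lemma coefs_in_poly n (f : nat -> L) :
  (forall i, (i < n)%N -> A (f i)) -> coefs_in A (\poly_(i < n) f i).
Proof. by move=> fA i; rewrite coef_poly; case: ltnP => [/fA|_] //; exact: subring0. Qed.

Lemma adjoin_subring y : subring (adjoin A y).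
Proof.
split => [|_ _ [p pA ->] [q qA ->]|_ _ [p pA ->] [q qA ->]].
- by exists 1; [exact: coefs_inC subring1 | rewrite hornerC].
- by exists (p - q); [move=> i; rewrite coefB; exact: subringB | rewrite !hornerE].
- exists (p * q); last by rewrite hornerM.
  by move=> i; rewrite coefM; apply: subring_sum => j _; exact: subringM.
Qed.

Lemma sub_adjoin y : A `<=` adjoin A y.
Proof. by move=> x xA; exists x%:P; [exact: coefs_inC | rewrite hornerC]. Qed.

Lemma mem_adjoin y : adjoin A y y.
Proof.
exists 'X; last by rewrite hornerX.
by move=> i; rewrite coefX; case: eqP => _; [exact: subring1 | exact: subring0].
Qed.

(** An expression of x as a polynomial in 1/x becomes an equation of integral
    dependence after multiplication by a power of x. *)
Lemma adjoinV_integral x : adjoin A x^-1 x -> integral A x.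
Proof.
case=> p pA xp; have [x0|x0] := eqVneq x 0.
  exists 'X; split; rewrite ?monicX ?x0 ?rootE ?hornerX //.
  by move=> i; rewrite coefX; case: eqP => _; [exact: subring1 | exact: subring0].
pose q := \poly_(j < size p) p`_(size p - j.+1).
have sq : (size q <= size p)%N by exact: size_poly.
exists ('X^(size p) - q); split.
- rewrite monicE lead_coefDl ?lead_coefXn // size_polyN size_polyXn.
  by rewrite ltnS.
- move=> i; rewrite coefB coefXn; apply: subringB.
    by case: eqP => _; [exact: subring1 | exact: subring0].
  exact: coefs_in_poly.
- rewrite rootE hornerD hornerN hornerXn horner_poly.
  rewrite (reindex_inj rev_ord_inj) /=.
  have [m sp] : exists m, size p = m.+1.
    case: (size p) (size_poly_eq0 p) => [|m _]; last by exists m.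
    by move=> /esym/eqP p0; move: x0; rewrite xp p0 horner0 eqxx.
  rewrite sp exprS {1}xp horner_coef sp mulr_suml subr_eq0.
  apply/eqP/eq_bigr => i _.
  rewrite !subSS subKn ?leq_ord //.
  rewrite -mulrA; congr (_ * _).
  by rewrite expfB_cond ?(negPf x0) ?leq_ord // exprVn mulrC.
Qed.

End SubringTheory.

(** Zorn's lemma; the empty set is included as well, being the union of the empty
    chain. *)
Lemma maximal_subring A y : subring A -> ~ adjoin A y y^-1 ->
  exists B, [/\ subring B, A `<=` B, B y, ~ B y^-1 &
    forall C, subring C -> B `<=` C -> ~ C y^-1 -> C `<=` B].
Proof.
move=> subA yA.
pose good B := [/\ subring B, A `<=` B, B y & ~ B y^-1].
have good0 : good (adjoin A y).
  by split; [exact: adjoin_subring | exact: sub_adjoin | exact: mem_adjoin |].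
case: (@Zorn_bigcup L (fun B => B = set0 \/ good B)) => [C Cgood Ctot|B [Bgood Bmax]].
  have [[B0 CB0 B0good]|none] := pselect (exists2 B, C B & good B); last first.
    left; apply/seteqP; split => // x [B CB Bx].
    case: (Cgood B CB) => [B0|Bg]; first by rewrite B0 in Bx.
    by case: none; exists B.
  have Cg B x : C B -> B x -> good B.
    by move=> /Cgood[->|//].
  have pair (x z : L) : (\bigcup_(B in C) B) x -> (\bigcup_(B in C) B) z ->
      exists B, [/\ C B, good B, B x & B z].
    move=> [B1 CB1 B1x] [B2 CB2 B2z]; case: (Ctot _ _ CB1 CB2) => sB.
    - by exists B2; split => //; [exact: (Cg _ z) | exact: sB].
    - by exists B1; split => //; [exact: (Cg _ x) | exact: sB].
  case: (B0good) => sub0 A0 y0 _; right; split.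
  - split => [|x z Bx Bz|x z Bx Bz].
    + by exists B0 => //; exact: subring1.
    + have [B [CB [sB _ _ _] xB zB]] := pair _ _ Bx Bz.
      by exists B => //; exact: subringB.
    + have [B [CB [sB _ _ _] xB zB]] := pair _ _ Bx Bz.
      by exists B => //; exact: subringM.
  - by move=> x /A0; exists B0.
  - by exists B0.
  - by move=> [B CB By]; case: (Cg _ _ CB By).
have {}Bgood : good B.
  case: Bgood => // B0; case: (Bmax (adjoin A y)); last by right.
  by rewrite B0; split=> // /(_ y (mem_adjoin subA y)).
case: (Bgood) => sB AB By By'; exists B; split => // C sC BC Cy x Cx.
apply: contrapT => Bx; apply: (Bmax C); first by split => // /(_ x Cx).
by right; split => //; [exact: subset_trans BC | exact: BC].
Qed.

Section MaximalSubring.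
Variables (B : set L) (y : L).
Hypotheses (sB : subring B) (By : B y) (By' : ~ B y^-1).
Hypothesis maxB : forall C, subring C -> B `<=` C -> ~ C y^-1 -> C `<=` B.

Let y0 : y != 0.
Proof. by apply/eqP => y0; apply: By'; rewrite y0 invr0; exact: subring0. Qed.

Lemma maximal_adjoin z : ~ B z -> adjoin B z y^-1.
Proof.
move=> Bz; apply: contrapT => nz; apply: Bz.
by apply: (maxB (adjoin_subring sB z)) => //; [exact: sub_adjoin | exact: mem_adjoin].
Qed.

(** y lies in the Jacobson radical: were u = 1 - y b not invertible in B, some
    power of u would be a multiple of y, and so would 1. *)
Lemma maximal_unit b : B b -> B (1 - y * b)^-1.
Proof.
move=> Bb; apply: contrapT => Bu; set u := 1 - y * b in Bu.
have u0 : u != 0 by apply/eqP => u0; apply: Bu; rewrite u0 invr0; exact: subring0.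
have Bu1 : B u by apply: subringB => //; [exact: subring1 | exact: subringM].
have powu n : exists2 b', B b' & u ^+ n = 1 - y * b'.
  elim: n => [|n [b' Bb' un]].
    by exists 0; [exact: subring0 | rewrite mulr0 subr0].
  exists (b' + b * (1 - y * b')); last by rewrite exprS un /u; ring.
  apply: subringD => //; apply: subringM => //.
  by apply: subringB => //; [exact: subring1 | exact: subringM].
have [p pB yp] := maximal_adjoin Bu.
have [b' Bb' un] := powu (size p).
have Bc : B (y^-1 * u ^+ size p).
  rewrite yp horner_coef mulr_suml; apply: subring_sum => // i _.
  rewrite -mulrA exprVn; apply: subringM => //.
  rewrite mulrC -expfB_cond ?(negPf u0) ?(ltnW (ltn_ord i)) //.
  exact: subringX.
apply: By'; have -> : y^-1 = y^-1 * u ^+ size p + b' by rewrite un; field.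
exact: subringD.
Qed.

(** By the second equation z ^+ s, for s the degree of p, is a combination of
    lower powers of z, the coefficient 1 - y q_0 being invertible in B; this
    eliminates the leading term of p. *)
Lemma maximal_reduce z p q : z != 0 -> coefs_in B p -> coefs_in B q ->
  p.[z] = y^-1 -> q.[z^-1] = y^-1 -> (size q <= size p)%N ->
  exists p', [/\ coefs_in B p', p'.[z] = y^-1 & (size p' < size p)%N].
Proof.
move=> z0 pB qB py qy qp.
have [s sp] : exists s, size p = s.+1.
  case: (size p) (size_poly_eq0 p) => [|m _]; last by exists m.
  by move=> /esym/eqP p0; case: By'; rewrite -py p0 horner0; exact: subring0.
rewrite sp in qp *.
have Bw := maximal_unit (qB 0%N); set w := _^-1 in Bw.
have w0 : 1 - y * q`_0 != 0.
  apply/eqP => q0; apply: By'; have -> : y^-1 = q`_0; last exact: qB.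
  by apply: (mulfI y0); rewrite mulfV //; apply/eqP; rewrite -subr_eq0 q0.
pose c := p`_s * y * w.
exists (\poly_(i < s) (p`_i + c * q`_(s - i))); split.
- apply: coefs_in_poly => // i _; apply: subringD => //; apply: subringM => //.
  by apply: subringM => //; exact: subringM.
- rewrite horner_poly -py (horner_coef_wide _ (eq_leq sp)) big_ord_recr /=.
  under eq_bigr do rewrite mulrDl.
  rewrite big_split /=; congr (_ + _).
  have : z ^+ s * (y^-1 - q`_0) = \sum_(i < s) q`_(s - i) * z ^+ i.
    rewrite -qy (horner_coef_wide _ qp) big_ord_recl expr0 mulr1 addrC addKr.
    rewrite mulr_sumr (reindex_inj rev_ord_inj) /=; apply: eq_bigr => i _.
    rewrite /bump /= add1n subnSK // mulrCA; congr (_ * _).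
    rewrite exprVn -expfB_cond ?(negPf z0) ?leq_subr // subKn //.
    exact: ltnW.
  under [X in _ = X -> _]eq_bigr do idtac.
  move=> sumq; under eq_bigr do rewrite -mulrA.
  rewrite -mulr_sumr -sumq /c /w; field.
  by rewrite y0.
- by rewrite ltnS size_poly.
Qed.

(** If neither z nor its inverse were in B, both would generate y^-1 over B, and
    such a pair of expressions could be reduced in degree for ever. *)
Lemma maximal_valuation : valuation_subring B.
Proof.
split => // z; apply: contrapT => /not_orP[Bz Bz'].
have z0 : z != 0 by apply/eqP => z0; apply: Bz; rewrite z0; exact: subring0.
have [p pB /esym py] := maximal_adjoin Bz.
have [q qB /esym qy] := maximal_adjoin Bz'.
have [N] := ubnP (size p + size q)%N.
elim: N p q pB qB py qy => // N IH p q pB qB py qy leN.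
have [qp|pq] := leqP (size q) (size p).
  have [p' [p'B p'y lt]] := maximal_reduce z0 pB qB py qy qp.
  by apply: (IH p' q) => //; lia.
rewrite -[z in p.[z]]invrK in py.
have z'0 : z^-1 != 0 by rewrite invr_eq0.
have [q' [q'B q'y lt]] := maximal_reduce z'0 qB pB qy py (ltnW pq).
by apply: (IH p q') => //; [rewrite -[z]invrK | lia].
Qed.

End MaximalSubring.

(** Chevalley's extension theorem, applied to 1/x in A[1/x]. *)
Lemma valuation_subring_exists A x : subring A -> ~ integral A x ->
  exists B, [/\ valuation_subring B, A `<=` B & ~ B x].
Proof.
move=> subA nx.
have [|B [sB AB Bx Bx' maxB]] := @maximal_subring A x^-1 subA.
  by rewrite invrK => /(adjoinV_integral subA).
exists B; split => //; last by rewrite -[x]invrK.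
exact: (maximal_valuation (y := x^-1)).
Qed.

End ValuationSubrings.

(** * Discrete valuations from valuation rings *)

Section ValuationSubringTheory.
Variable L : fieldType.
Implicit Types (x y z : L).
Variables (B : set L) (vB : valuation_subring B).

Let sB : subring B. Proof. by case: vB. Qed.

(** The maximal ideal of B; 0 is listed apart because its inverse is 0. *)
Definition nonunit : set L := [set x | x = 0 \/ ~ B x^-1].

Definition vunit : set L := [set x | [/\ x != 0, B x & B x^-1]].

Lemma nonunit_mem x : nonunit x -> B x.
Proof. by case=> [->|Bx]; [exact: subring0 | case: vB => _ /(_ x)[]]. Qed.

Lemma nonunit1 : ~ nonunit 1.
Proof.
by case=> [/eqP|]; rewrite ?oner_eq0 // invr1; apply; exact: subring1.
Qed.

Lemma not_nonunit x : B x -> ~ nonunit x -> vunit x.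
Proof.
by move=> Bx /not_orP[/eqP x0 /contrapT xV]; split.
Qed.

Lemma nonunitMl x y : B x -> nonunit y -> nonunit (x * y).
Proof.
move=> Bx [->|By]; first by left; rewrite mulr0.
have [->|x0] := eqVneq x 0; first by left; rewrite mul0r.
right=> xyV; apply: By; have -> : y^-1 = x * (x * y)^-1.
  by rewrite invfM mulVKf.
exact: subringM.
Qed.

Lemma nonunitN x : nonunit x -> nonunit (- x).
Proof. by rewrite -mulN1r; apply: nonunitMl; apply: subringN => //; exact: subring1. Qed.

Lemma nonunitD x y : nonunit x -> nonunit y -> nonunit (x + y).
Proof.
have wlog_div u w : w != 0 -> B (u / w) -> nonunit w -> nonunit (u + w).
  move=> w0 Buw nw; have -> : u + w = (u / w + 1) * w by field.
  by apply: nonunitMl => //; apply: subringD => //; exact: subring1.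
move=> nx ny; have [->|x0] := eqVneq x 0; first by rewrite add0r.
have [->|y0] := eqVneq y 0; first by rewrite addr0.
case: vB => _ /(_ (x / y))[xy|]; first exact: wlog_div.
by rewrite invfM invrK mulrC addrC => xy; exact: wlog_div.
Qed.

Lemma nonunit_sum I (r : seq I) (P : pred I) (f : I -> L) :
  (forall i, P i -> nonunit (f i)) -> nonunit (\sum_(i <- r | P i) f i).
Proof. by move=> fA; apply: big_ind => //; [left | exact: nonunitD]. Qed.

(** Otherwise 1/x is a non-unit, and an equation of integral dependence divided by
    the highest power of x writes 1 as a sum of non-units. *)
Lemma valuation_subring_closed x : integral B x -> B x.
Proof.
case=> p [pm pB px]; apply: contrapT => Bx.
have nx : nonunit x^-1 by right; rewrite invrK.
have x0 : x != 0 by apply/eqP => x0; apply: Bx; rewrite x0; exact: subring0.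
have [m sp] : exists m, size p = m.+1.
  by exists (size p).-1; rewrite prednK // size_poly_gt0 monic_neq0.
move: px; rewrite rootE horner_coef sp big_ord_recr /=.
have -> : p`_m = 1 by move/monicP: pm; rewrite lead_coefE sp.
rewrite mul1r => /eqP sum0; apply: nonunit1.
have -> : 1 = - \sum_(i < m) p`_i * x^-1 ^+ (m - i).
  apply: (mulIf (expf_neq0 m x0)); rewrite mul1r mulNr mulr_suml.
  rewrite -[LHS](addKr (\sum_(i < m) p`_i * x ^+ i)) sum0 addr0.
  congr (- _); apply: eq_bigr => i _; rewrite -mulrA exprVn; congr (_ * _).
  by rewrite mulrC -expfB_cond ?(negPf x0) ?leq_subr // subKn // ltnW.
apply: nonunitN; apply: nonunit_sum => i _; apply: nonunitMl => //.
have [j ->] : exists j, (m - i)%N = j.+1.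
  by exists (m - i).-1; rewrite prednK // subn_gt0.
rewrite exprSr; apply: nonunitMl => //; apply: subringX => //.
exact: nonunit_mem.
Qed.

Lemma valuation_subring_max (s : seq L) : (exists2 x, x \in s & x != 0) ->
  exists t, [/\ t \in s, t != 0 & forall x, x \in s -> B (x / t)].
Proof.
elim: s => [[]//|y s IH [x1 x1s x10]].
have [[x xs x0]|none] := pselect (exists2 x, x \in s & x != 0); last first.
  have s0 x : x \in s -> x = 0.
    by move=> xs; apply: contrapT => /eqP x0; apply: none; exists x.
  have y0 : y != 0.
    by move: x1s; rewrite inE => /predU1P[<-//|/s0 x1E]; rewrite x1E eqxx in x10.
  exists y; rewrite mem_head; split=> // x; rewrite inE => /predU1P[->|/s0 ->].
    by rewrite mulfV //; exact: subring1.
  by rewrite mul0r; exact: subring0.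
have [t [ts t0 tmax]] : exists t, [/\ t \in s, t != 0 & forall x, x \in s -> B (x / t)].
  by apply: IH; exists x.
case: vB => _ /(_ (y / t))[Byt|Bty].
  by exists t; rewrite inE ts orbT; split=> // u; rewrite inE => /predU1P[->//|/tmax].
have [y0|y0] := eqVneq y 0.
  exists t; rewrite inE ts orbT; split=> // u; rewrite inE => /predU1P[->|/tmax//].
  by rewrite y0 mul0r; exact: subring0.
exists y; rewrite mem_head; split=> // u; rewrite inE => /predU1P[->|/tmax Bu].
  by rewrite mulfV //; exact: subring1.
have -> : u / y = (u / t) * (y / t)^-1 by field; rewrite y0 t0.
exact: subringM.
Qed.

(** Divide by a term of least valuation: if all other quotients were non-units, so
    would be their sum, which is -1. *)
Lemma vanishing_sum N (t : 'I_N -> L) : \sum_i t i = 0 -> (exists i, t i != 0) ->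
  exists i j, [/\ i != j, t i != 0, t j != 0 & vunit (t i / t j)].
Proof.
move=> sum0 [i0 ti0].
have [|u [/codomP[j uj] u0 umax]] := @valuation_subring_max (codom t).
  by exists (t i0) => //; exact: codom_f.
rewrite uj in u0 umax; apply: contrapT => none; apply: nonunit1.
have -> : 1 = - \sum_(i | i != j) t i / t j.
  apply: (mulIf u0); rewrite mul1r mulNr mulr_suml.
  under eq_bigr do rewrite mulfVK //.
  by move: sum0; rewrite (bigD1 j) //= => /eqP; rewrite addr_eq0 => /eqP.
apply: nonunitN; apply: nonunit_sum => i ij; apply: contrapT => nu; apply: none.
have Bij : B (t i / t j) by apply: umax; exact: codom_f.
have uij := not_nonunit Bij nu; exists i, j; split => //.
by case: uij => + _ _; rewrite mulf_eq0 => /norP[].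
Qed.

Lemma vunitM x y : vunit x -> vunit y -> vunit (x * y).
Proof.
move=> [x0 Bx Bx'] [y0 By By']; split; first by rewrite mulf_neq0.
  exact: subringM.
by rewrite invfM; exact: subringM.
Qed.

Lemma vunitV x : vunit x -> vunit x^-1.
Proof. by move=> [x0 Bx Bx']; split; rewrite ?invr_eq0 // invrK. Qed.

Lemma vunit1 : vunit 1.
Proof. by split; rewrite ?oner_eq0 // ?invr1; exact: subring1. Qed.

Lemma vunitX x n : vunit x -> vunit (x ^+ n).
Proof.
move=> ux; elim: n => [|n IH]; first exact: vunit1.
by rewrite exprS; exact: vunitM.
Qed.

Lemma vunitXz x (m : int) : vunit x -> vunit (x ^ m).
Proof.
case: m => n ux; first exact: vunitX.
by rewrite NegzE -exprnN; apply: vunitV; exact: vunitX.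
Qed.

Section Discrete.
Variables (pi : L) (N : nat).
Hypotheses (pi0 : pi != 0) (npi : ~ B pi^-1) (N_gt0 : (0 < N)%N).
Hypothesis powN : forall x, x != 0 -> exists j : int, vunit (x ^+ N * pi ^ (- j)).

Let Bpi : B pi. Proof. by apply: nonunit_mem; right. Qed.

Let pi_unit (j : int) : B (pi ^ j) -> 0 <= j.
Proof.
move=> Bj; rewrite leNgt; apply/negP => j0; apply: npi.
have [i ij] : exists i : nat, j = - i.+1%:Z by exists `|j|.-1%N; lia.
have -> : pi^-1 = pi ^ j * pi ^+ i.
  by rewrite ij -exprnN exprSr invfM mulrAC mulVf ?mul1r // expf_neq0.
by apply: subringM => //; exact: subringX.
Qed.

Let val_ex : exists w : L -> int, forall x, x != 0 -> vunit (x ^+ N * pi ^ (- w x)).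
Proof.
have /choice[w wP] : forall x, exists j : int, x != 0 -> vunit (x ^+ N * pi ^ (- j)).
  move=> x; have [->|x0] := eqVneq x 0; first by exists 0.
  by have [j] := powN x0; exists j.
by exists w => x; exact: wP.
Qed.

Let val_unique x (i j : int) : x != 0 ->
  vunit (x ^+ N * pi ^ (- i)) -> vunit (x ^+ N * pi ^ (- j)) -> i = j.
Proof.
move=> x0.
have le (i' j' : int) : vunit (x ^+ N * pi ^ (- i')) ->
    vunit (x ^+ N * pi ^ (- j')) -> i' <= j'.
  move=> ui uj; have [_ B1 _] := vunitM ui (vunitV uj).
  rewrite -subr_ge0; apply: pi_unit; move: B1; rewrite invfM.
  rewrite mulrACA mulfV ?expf_neq0 // mul1r invr_expz opprK -expfzDr //.
  by rewrite addrC.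
by move=> ui uj; apply/eqP; rewrite eq_le !le.
Qed.

(** The exponent w with x ^+ N ~ pi ^ w is additive and cuts out B; dividing it
    by its smallest positive value makes it onto. *)
Lemma discrete_valuation : exists v : L -> int,
  [/\ forall x y, x != 0 -> y != 0 -> v (x * y) = v x + v y,
      forall x, x != 0 -> B x <-> 0 <= v x
    & exists2 x, x != 0 & v x = 1].
Proof.
have [w wP] := val_ex.
have wM x y : x != 0 -> y != 0 -> w (x * y) = w x + w y.
  move=> x0 y0; have xy0 : x * y != 0 by rewrite mulf_neq0.
  apply: (val_unique xy0); first exact: wP.
  by rewrite opprD expfzDr // exprMn mulrACA; apply: vunitM; exact: wP.
have wB x : x != 0 -> B x <-> 0 <= w x.
  move=> x0; have [ux Bx Bx'] := wP x x0; split => [xB|].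
    apply: pi_unit; have -> : pi ^ w x = x ^+ N * (x ^+ N * pi ^ (- w x))^-1.
      by rewrite invfM mulVKf ?expf_neq0 // invr_expz opprK.
    by apply: subringM => //; exact: subringX.
  move=> w_ge0; have [//|xV] : B x \/ B x^-1 by case: vB.
  have BxN : B (x ^+ N).
    have -> : x ^+ N = x ^+ N * pi ^ (- w x) * pi ^ w x.
      by rewrite -mulrA -expfzDr // addNr mulr1.
    apply: subringM => //; case: (w x) w_ge0 => // n _; exact: subringX.
  have -> : x = x ^+ N * x^-1 ^+ N.-1.
    by rewrite -{1}(prednK N_gt0) exprS -mulrA -exprMn mulfV // expr1n mulr1.
  by apply: subringM => //; exact: subringX.
have wpi : w pi = N%:Z.
  apply: (val_unique pi0); first exact: wP.
  by rewrite -exprnN mulfV ?expf_neq0 //; exact: vunit1.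
have pos : exists g : nat, `[< exists2 x, x != 0 & w x = g.+1%:Z >].
  by exists N.-1; apply/asboolP; exists pi => //; rewrite wpi prednK.
have [g /asboolP[x1 x10 wx1] gmin] := ex_minnP pos.
have wX x (m : int) : x != 0 -> w (x ^ m) = w x * m.
  move=> x0; apply: (val_unique (x := x ^ m)); rewrite ?expfz_neq0 //.
    by apply: wP; rewrite expfz_neq0.
  have -> : (x ^ m) ^+ N * pi ^ (- (w x * m)) = (x ^+ N * pi ^ (- w x)) ^ m.
    by rewrite -mulNr -exprz_exp !exprnP exprzAC -expfzMl.
  by apply: vunitXz; exact: wP.
have wdiv x : x != 0 -> exists j : int, w x = j * g.+1%:Z.
  move=> x0; exists (w x %/ g.+1)%Z.
  have := divz_eq (w x) g.+1; set q := (_ %/ _)%Z; set r := (_ %% _)%Z => eqw.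
  have : w (x * x1 ^ (- q)) = r.
    by rewrite wM ?expfz_neq0 // wX // wx1; lia.
  have r_ge0 : 0 <= r by exact: modz_ge0.
  have r_lt : r < g.+1%:Z by exact: ltz_pmod.
  case: (posnP `|r|%N) => [r0 _|r_gt0 wr]; first lia.
  have : (g <= `|r|.-1)%N.
    apply: gmin; apply/asboolP; exists (x * x1 ^ (- q)).
      by rewrite mulf_neq0 ?expfz_neq0.
    lia.
  lia.
exists (fun x => (w x %/ g.+1)%Z); split.
- move=> x y x0 y0; rewrite wM //.
  have [i ->] := wdiv x x0; have [j ->] := wdiv y y0.
  by rewrite -mulrDl !mulzK.
- move=> x x0; rewrite wB //; have [i ->] := wdiv x x0.
  by rewrite mulzK // pmulr_lge0.
- by exists x1 => //; rewrite wx1 divzz.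
Qed.

End Discrete.

End ValuationSubringTheory.

Section PlaceOfSubring.
Variables (k : fieldType) (F : fieldExtType (ratfun k)).

Lemma place_of_valuation (B : set F) (v : F -> int) :
  valuation_subring B -> (forall c : k, B (tofrac c%:P)%:A) ->
  (forall x y, x != 0 -> y != 0 -> v (x * y) = v x + v y) ->
  (forall x, x != 0 -> B x <-> 0 <= v x) -> (exists2 x, x != 0 & v x = 1) ->
  exists P : place F, forall x, B x <-> vge P 0 x.
Proof.
move=> vB Bk vM v_ge0 [x1 x10 vx1].
pose w x : \bar int := if x == 0 then +oo%E else (v x)%:E.
have sB : subring B by case: vB.
have w0 : w 0 = +oo%E by rewrite /w eqxx.
have wE x : x != 0 -> w x = (v x)%:E by rewrite /w; case: eqP.
have v1 : v 1 = 0 by have := vM 1 1 (oner_neq0 _) (oner_neq0 _); rewrite mulr1; lia.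
have vV x : x != 0 -> v x^-1 = - v x.
  move=> x0; have := vM x x^-1 x0; rewrite invr_eq0 => /(_ x0).
  by rewrite mulfV // v1; lia.
have vX x (m : int) : x != 0 -> v (x ^ m) = v x * m.
  move=> x0.
  have vXn (n : nat) : v (x ^+ n) = v x * n%:Z.
    elim: n => [|n IH]; first by rewrite v1 mulr0.
    by rewrite exprS vM ?expf_neq0 // IH; lia.
  case: m => n; first exact: vXn.
  by rewrite NegzE -exprnN vV ?expf_neq0 // vXn; lia.
have vD x y : x != 0 -> y != 0 -> x + y != 0 -> v x <= v y -> v x <= v (x + y).
  move=> x0 y0 xy0 xy.
  have xyE : x + y = x * (1 + y / x) by field.
  have u0 : 1 + y / x != 0.
    by apply: contra_neq xy0 => u0; rewrite xyE u0 mulr0.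
  rewrite xyE vM // lerDl -v_ge0 //; apply: subringD => //; first exact: subring1.
  by apply/v_ge0; rewrite ?mulf_neq0 ?invr_eq0 // vM ?invr_eq0 // vV // subr_ge0.
have wP : is_place w.
  split.
  - by move=> x; rewrite /w; case: eqP.
  - move=> x y; have [->|x0] := eqVneq x 0.
      by rewrite mul0r w0; have [->|y0] := eqVneq y 0; rewrite ?w0 ?wE.
    have [->|y0] := eqVneq y 0; first by rewrite mulr0 w0 wE.
    by rewrite !wE ?mulf_neq0 // vM.
  - move=> x y; have [->|x0] := eqVneq x 0.
      by rewrite add0r w0 ge_min lexx orbT.
    have [->|y0] := eqVneq y 0; first by rewrite addr0 ge_min lexx.
    have [->|xy0] := eqVneq (x + y) 0; first by rewrite w0 leey.
    rewrite !wE // ge_min !lee_fin; case: (leP (v x) (v y)) => [xy|/ltW yx].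
      by rewrite vD.
    by rewrite [x + y]addrC vD ?orbT // addrC.
  - move=> c c0.
    pose u : F := (tofrac c%:P)%:A; rewrite -/u.
    have u0 : u != 0 by rewrite alg_eq0 tofrac_eq0 polyC_eq0.
    have Bu : B u by exact: Bk.
    have Bu' : B u^-1.
      rewrite (@mulr1_eq _ u (tofrac (c^-1)%:P)%:A) //.
      by rewrite -algM -tofracM -polyCM mulfV // polyC1 tofrac1 scale1r.
    rewrite wE //; congr (_%:E).
    move/(v_ge0 _ u0): Bu; rewrite v_ge0 ?invr_eq0 // vV // in Bu'.
    by move=> ?; lia.
  - apply/seteqP; split => [_ [x _ <-]|m mN] /=.
      by rewrite /w; case: eqP.
    case: m mN => [m _|_|//]; last by exists 0.
    by exists (x1 ^ m) => //; rewrite wE ?expfz_neq0 // vX // vx1 mul1r.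
exists (Place wP) => x; rewrite /vge /=; have [->|x0] := eqVneq x 0.
  by rewrite w0 leey; split => // _; exact: subring0.
by rewrite wE // lee_fin; exact: v_ge0.
Qed.

End PlaceOfSubring.

(** * Existence of places *)

Lemma mul_denom_repr (R : idomainType) (c : {fraction R}) :
  c * tofrac \d_(repr c) = tofrac \n_(repr c).
Proof.
rewrite -{1}[c]reprK; move: (repr c) => x; unlock tofrac.
rewrite -[LHS]FracField.pi_mul; apply/eqmodP.
rewrite /= FracField.equivfE /FracField.mulf.
by rewrite !numden_Ratio ?oner_eq0 ?mulr1 ?denom_ratioP // mulrC.
Qed.

Section PolynomialsInF.
Variables (k : fieldType) (F : fieldExtType (ratfun k)).

Definition pol (a : {poly k}) : F := (tofrac a)%:A.

Lemma pol_is_zmod_morphism : zmod_morphism pol.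
Proof. by move=> a b; rewrite /pol tofracB scalerBl. Qed.

Lemma pol_is_monoid_morphism : monoid_morphism pol.
Proof.
by split=> [|a b]; rewrite /pol ?tofrac1 ?scale1r // tofracM algM.
Qed.

HB.instance Definition _ := GRing.isZmodMorphism.Build _ _ pol pol_is_zmod_morphism.
HB.instance Definition _ := GRing.isMonoidMorphism.Build _ _ pol pol_is_monoid_morphism.

Lemma pol_eq0 a : (pol a == 0) = (a == 0).
Proof. by rewrite /pol alg_eq0 tofrac_eq0. Qed.

Lemma alg_frac (c : ratfun k) : exists a b, b != 0 /\ (c%:A : F) = pol a / pol b.
Proof.
pose r := repr c; exists \n_r, \d_r; split; first exact: denom_ratioP.
have d0 : pol \d_r != 0 by rewrite pol_eq0 denom_ratioP.
by apply: (mulIf d0); rewrite mulfVK // /pol -algM mul_denom_repr.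
Qed.

Lemma polE a : pol a = \sum_(i < size a) pol (a`_i)%:P * pol 'X ^+ i.
Proof.
rewrite -{1}[a]coefK poly_def rmorph_sum; apply: eq_bigr => i _.
by rewrite -mul_polyC rmorphM rmorphXn.
Qed.

Lemma algebraic_over_ratfun (x : F) : integral [set c%:A | c in [set: ratfun k]] x.
Proof.
exists (minPoly 1 x); split; first exact: monic_minPoly.
  move=> i; have /polyOverP/(_ i)/vlineP[c ->] := minPolyOver 1 x.
  by exists c.
exact: root_minPoly.
Qed.

Lemma poly_valuation (p g : {poly k}) : (1 < size p)%N -> g != 0 ->
  exists i g', g = p ^+ i * g' /\ ~~ (p %| g').
Proof.
move=> p1; have [N] := ubnP (size g); elim: N g => // N IH g leN g0.
have [pg|npg] := boolP (p %| g); last by exists 0%N, g; rewrite mul1r.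
have gE := divpK pg.
have q0 : g %/ p != 0 by apply: contra_neq g0 => q0; rewrite -gE q0 mul0r.
have p0 : p != 0 by rewrite -size_poly_gt0 ltnW.
have [|i [g' [qE npg']]] := IH (g %/ p) _ q0.
  rewrite size_divp //; apply: leq_trans (leN : (size g <= N)%N).
  by rewrite ltn_subrL size_poly_gt0 g0 andbT -ltnS prednK // ltnW.
by exists i.+1, g'; rewrite exprS -mulrA -qE mulrC gE.
Qed.

(** Powers of p are split off from numerator and denominator; for irreducible p the
    exponent is the p-adic valuation. *)
Lemma alg_valuation (p : {poly k}) (c : ratfun k) : (1 < size p)%N ->
  (c%:A : F) != 0 -> exists (j : int) a b,
  [/\ ~~ (p %| a), ~~ (p %| b) & (c%:A : F) = pol p ^ j * (pol a / pol b)].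
Proof.
move=> p1 c0; have [a [b [b0 cE]]] := alg_frac c.
have a0 : a != 0 by apply: contra_neq c0 => a0; rewrite cE a0 rmorph0 mul0r.
have pp0 : pol p != 0 by rewrite pol_eq0 -size_poly_gt0 ltnW.
have [i [a' [aE pa]]] := poly_valuation p1 a0.
have [j [b' [bE pb]]] := poly_valuation p1 b0.
exists (i%:Z - j%:Z), a', b'; split => //.
rewrite cE aE bE !rmorphM !rmorphXn invfM expfzDr // -exprnN.
by rewrite mulrACA.
Qed.

End PolynomialsInF.
Arguments pol {k} F a.

Section PlaceExistence.
Variables (k : fieldType) (F : fieldExtType (ratfun k)).
Implicit Types (P Q : place F) (x y z : F) (a b f g p : {poly k}).

Section SubringOfF.
Variables (B : set F) (vB : valuation_subring B).
Hypotheses (Bk : forall c : k, B (pol F c%:P)) (properB : exists x, ~ B x).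

Let sB : subring B. Proof. by case: vB. Qed.

Let const_unit (c : k) : c != 0 -> vunit B (pol F c%:P).
Proof.
move=> c0; apply: (not_nonunit (Bk c)) => nc; apply: (nonunit1 vB).
have -> : 1 = pol F (c^-1)%:P * pol F c%:P.
  by rewrite -rmorphM -polyCM mulVf // rmorph1.
exact: nonunitMl.
Qed.

Let ratfun_proper : exists c : ratfun k, ~ B c%:A.
Proof.
apply: contrapT => all; case: properB => x; apply.
have {}all (c : ratfun k) : B c%:A by apply: contrapT => nc; apply: all; exists c.
apply: (valuation_subring_closed vB).
have [p [pm pK px]] := algebraic_over_ratfun x; exists p; split => //.
by move=> i; have [c _ <-] := pK i.
Qed.

Let polX_in : B (pol F 'X) -> forall a, B (pol F a).
Proof.
move=> BX a; rewrite polE; apply: subring_sum => // i _.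
by apply: subringM => //; exact: subringX.
Qed.

(** If B contains t, a uniformiser is a polynomial p of minimal degree among the
    non-units: a polynomial not divisible by p has a nonzero remainder modulo p,
    which is a unit, so it is a unit itself. Otherwise 1/t is a uniformiser. *)
Lemma ratfun_uniformizer : exists u : F, [/\ u != 0, ~ B u^-1 &
  forall c : ratfun k, (c%:A : F) != 0 -> exists j : int, vunit B (c%:A * u ^ (- j))].
Proof.
have [BX|nBX] := pselect (B (pol F 'X)).
  have Bpol := polX_in BX.
  have ex : exists n, `[< exists f, [/\ size f = n, f != 0 & ~ B (pol F f)^-1] >].
    apply: contrapT => none; case: ratfun_proper => c; apply.
    have [a [b [b0 ->]]] := alg_frac F c; apply: subringM => //.
    by apply: contrapT => nb; apply: none; exists (size b); apply/asboolP; exists b.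
  have [n /asboolP[p [sp p0 np]] nmin] := ex_minnP ex.
  have p1 : (1 < size p)%N.
    rewrite ltnNge; apply/negP => /size1_polyC pE; apply: np.
    have c0 : p`_0 != 0 by apply: contra_neq p0 => c0; rewrite pE c0 polyC0.
    by rewrite pE; case: (const_unit c0).
  have pp0 : pol F p != 0 by rewrite pol_eq0.
  have unit_pol a : ~~ (p %| a) -> vunit B (pol F a).
    move=> pa; apply: (not_nonunit (Bpol a)) => na.
    have r0 : a %% p != 0 by [].
    have [/eqP|] : nonunit B (pol F (a %% p)); rewrite ?pol_eq0 ?(negPf r0) //.
      have -> : a %% p = a - a %/ p * p by rewrite {2}(divp_eq a p) addrAC subrr add0r.
      rewrite rmorphB rmorphM; apply: (nonunitD vB) => //; apply: (nonunitN vB).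
      by apply: (nonunitMl vB); [exact: Bpol | right].
    move=> nr; have : (n <= size (a %% p)%R)%N.
      by apply: nmin; apply/asboolP; exists (a %% p).
    by rewrite leqNgt -sp ltn_modp p0.
  exists (pol F p); split => // c c0.
  have [j [a [b [pa pb ->]]]] := alg_valuation p1 c0.
  exists j; rewrite mulrAC -expfzDr // subrr mul1r.
  by apply: vunitM => //; [exact: unit_pol | apply: vunitV; exact: unit_pol].
pose u := (pol F 'X)^-1.
have t0 : pol F 'X != 0 by rewrite pol_eq0 polyX_eq0.
have u0 : u != 0 by rewrite invr_eq0.
have nu : nonunit B u by right; rewrite invrK.
have unit_pol a : a != 0 -> vunit B (pol F a * u ^+ (size a).-1).
  move=> a0; have [m sa] : exists m, size a = m.+1.
    by exists (size a).-1; rewrite prednK // size_poly_gt0.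
  have lead0 : a`_m != 0 by move: a0; rewrite -lead_coef_eq0 lead_coefE sa.
  rewrite polE sa big_ord_recr /= mulrDl mulr_suml -mulrA -exprMn mulfV //.
  rewrite expr1n mulr1.
  set s := \sum_(i < m) _.
  have ns : nonunit B s.
    apply: nonunit_sum => // i _; rewrite -mulrA; apply: (nonunitMl vB (Bk _)).
    have -> : pol F 'X ^+ i * u ^+ m = u ^+ (m - i.+1) * u.
      rewrite -exprSr subnSK // !exprVn expfB_cond; first by rewrite invf_div.
      by rewrite (negPf t0) add0n; exact: ltnW.
    by apply: nonunitMl => //; apply: subringX => //; exact: nonunit_mem.
  have uc := const_unit lead0.
  apply: not_nonunit => [|ncs].
    by apply: subringD => //; exact: nonunit_mem.
  case: uc => c0 _ cV; have [/eqP|//] : nonunit B (pol F (a`_m)%:P).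
    by rewrite -[pol F _](addKr s); apply: (nonunitD vB) => //; exact: nonunitN.
  by rewrite (negPf c0).
exists u; split => //; first by rewrite invrK.
move=> c c0; have [a [b [b0 cE]]] := alg_frac F c.
have a0 : a != 0 by apply: contra_neq c0 => a0; rewrite cE a0 rmorph0 mul0r.
exists ((size b).-1%:Z - (size a).-1%:Z).
have -> : c%:A * u ^ (- ((size b).-1%:Z - (size a).-1%:Z)) =
    (pol F a * u ^+ (size a).-1) * (pol F b * u ^+ (size b).-1)^-1.
  by rewrite cE opprB expfzDr // -exprnN invfM mulrACA.
by apply: vunitM => //; [exact: unit_pol | apply: vunitV; exact: unit_pol].
Qed.

(** Since 1, x, ..., x ^+ n are dependent over k(t) for n = [F : k(t)], some
    power of x of exponent at most n has the valuation of an element of k(t), so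
    x ^+ n`! has the valuation of a power of the uniformiser of k(t). *)
Lemma place_of_subring : exists P : place F, forall x, B x <-> vge P 0 x.
Proof.
have [u [u0 nu uK]] := ratfun_uniformizer.
pose n := \dim {:F}.
have powN x : x != 0 -> exists j : int, vunit B (x ^+ n`! * u ^ (- j)).
  move=> x0; have [c [[i0 ci0] c0]] := @linear_dependence _ F n.+1 (fun i => x ^+ i) (leqnn _).
  have [||i [j [ij]]] := @vanishing_sum _ B vB _
    (fun i : 'I_n.+1 => (c i)%:A * x ^+ i).
  - by rewrite -[RHS]c0; apply: eq_bigr => i _; rewrite mulr_algl.
  - by exists i0; rewrite mulf_neq0 // expf_neq0.
  wlog ltij : i j ij / (j < i)%N.
    move=> W ti tj uij; have [lt|lt|/val_inj eq] := ltngtP i j.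
    + apply: (W j i) => //; first by rewrite eq_sym.
      by rewrite -invf_div; apply: vunitV.
    + exact: (W i j).
    + by rewrite eq eqxx in ij.
  rewrite !mulf_eq0 !negb_or => /andP[ci0' _] /andP[cj0 _] uij.
  have [d [d_gt0 dn]] : exists d, [/\ (0 < d)%N, (d <= n)%N & i = (j + d)%N :> nat].
    by exists (i - j)%N; have := ltn_ord i; split; lia.
  move=> iE; rewrite iE in uij.
  have ud : vunit B ((c i / c j)%:A * x ^+ d).
    have -> // : (c i / c j)%:A * x ^+ d = (c i)%:A * x ^+ (j + d) / ((c j)%:A * x ^+ j).
    by rewrite algM algV exprD; field; rewrite cj0 expf_neq0.
  have cij0 : ((c i / c j)%:A : F) != 0 by rewrite algM algV mulf_neq0 ?invr_eq0.
  have [m um] := uK _ cij0.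
  have /dvdnP[q ->] : (d %| n`!)%N by apply: dvdn_fact; rewrite d_gt0.
  exists (- m * q%:Z).
  have -> : x ^+ (q * d) * u ^ (- (- m * q%:Z)) =
    ((c i / c j)%:A * x ^+ d / ((c i / c j)%:A * u ^ (- m))) ^+ q.
    rewrite invfM mulrACA mulfV // mul1r invr_expz opprK exprMn -exprM mulnC.
    by rewrite mulNr opprK [(u ^ m) ^+ q]exprnP exprz_exp.
  by apply: vunitX => //; apply: vunitM => //; exact: vunitV.
have [v [vM v_ge0 v1]] := discrete_valuation vB u0 nu (fact_gt0 n) powN.
exact: (place_of_valuation vB Bk vM v_ge0 v1).
Qed.

End SubringOfF.

(** So the integral closure of A in F is the intersection of the valuation rings
    containing A. *)
Lemma place_exists (A : set F) x : subring A -> (forall c : k, A (pol F c%:P)) ->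
  ~ integral A x -> exists P, (forall z, A z -> vge P 0 z) /\ ~ vge P 0 x.
Proof.
move=> sA Ak /(valuation_subring_exists sA)[B [vB AB Bx]].
have [||P PB] := @place_of_subring B vB; first by move=> c; exact/AB.
  by exists x.
by exists P; split => [z /AB/PB|/PB].
Qed.

Lemma place_valuation_subring P : valuation_subring (vge P 0).
Proof.
split.
  split; first by rewrite -(vint1 P); exact: vge_vint.
    by move=> x y; exact: vgeB.
  by move=> x y; exact: vge0M.
move=> x; have [->|x0] := eqVneq x 0; first by left; exact: vge0.
by rewrite !vgeE ?invr_eq0 // vintV //; case: (lerP 0 (vint P x)); [left | right; lia].
Qed.

Lemma integral_vge P (A : set F) x : (forall z, A z -> vge P 0 z) ->
  integral A x -> vge P 0 x.
Proof.
move=> PA [p [pm pA px]]; apply: valuation_subring_closed.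
  exact: place_valuation_subring.
by exists p; split => // i; exact/PA.
Qed.

End PlaceExistence.

(** * Infinite and finite places *)

Section RationalDegree.
Variable k : fieldType.
Implicit Types (a b : {poly k}) (c : ratfun k).

Lemma rdeg_frac c a b : a != 0 -> b != 0 -> c * tofrac b = tofrac a ->
  rdeg c = ((size a)%:Z - (size b)%:Z)%:E.
Proof.
move=> a0 b0 cE.
have /negPf c0 : c != 0.
  by apply: contra_neq a0 => c0; apply/eqP; rewrite -tofrac_eq0 -cE c0 mul0r.
rewrite /rdeg c0; congr (_%:E).
have d0 := denom_ratioP (repr c).
have ab : \n_(repr c) * b = a * \d_(repr c).
  apply/eqP; rewrite -tofrac_eq !tofracM -cE -mul_denom_repr; apply/eqP; ring.
have n0 : \n_(repr c) != 0.
  apply: contra_neq (mulf_neq0 a0 d0) => n0; rewrite -ab n0 mul0r //.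
have := congr1 (size \o polyseq) ab.
rewrite /= !size_mul // => sab.
have := size_poly_gt0 a; have := size_poly_gt0 b.
have := size_poly_gt0 \n_(repr c); have := size_poly_gt0 \d_(repr c).
rewrite a0 b0 n0 d0; move: sab.
move: (size _) (size _) (size _) (size _) => u v w z; lia.
Qed.

Lemma rdeg0 : rdeg (0 : ratfun k) = -oo%E.
Proof. by rewrite /rdeg eqxx. Qed.

Lemma ratfun_frac c : c != 0 -> exists a b, [/\ a != 0, b != 0 & c * tofrac b = tofrac a].
Proof.
move=> c0; exists \n_(repr c), \d_(repr c); split; last exact: mul_denom_repr.
  rewrite -tofrac_eq0 -mul_denom_repr; apply: mulf_neq0; first exact: c0.
  by rewrite tofrac_eq0 denom_ratioP.
exact: denom_ratioP.
Qed.

End RationalDegree.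

Section InfinitePlaces.
Variables (k : fieldType) (F : fieldExtType (ratfun k)).
Implicit Types (P Q : place F) (x y z : F) (a b f g p : {poly k}).

Local Notation t := (pol F 'X).

Let t0 : t != 0. Proof. by rewrite pol_eq0 polyX_eq0. Qed.

(** The leading term dominates, t having a pole at P. *)
Lemma vint_pol_inf P a : vint P t < 0 -> a != 0 ->
  vint P (pol F a) = vint P t * (size a).-1%:Z.
Proof.
move=> Pt a0; have [m sa] : exists m, size a = m.+1.
  by exists (size a).-1; rewrite prednK // size_poly_gt0.
have lead0 : a`_m != 0 by move: a0; rewrite -lead_coef_eq0 lead_coefE sa.
have lc0 : pol F (a`_m)%:P != 0 by rewrite pol_eq0 polyC_eq0.
have tm0 : t ^+ m != 0 by rewrite expf_neq0.
have vlead : vint P (pol F (a`_m)%:P * t ^+ m) = vint P t * m%:Z.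
  by rewrite vintM // vint_const add0r vintX.
rewrite polE sa big_ord_recr /= addrC -vlead.
apply: (@vint_dom _ _ _ _ _ _ _).2; first by rewrite mulf_neq0.
rewrite vlead; apply: vge_sum => i _; apply: (@vgeW _ _ _ _ (0 + vint P t * i%:Z)).
  by have := ltn_ord i; nia.
apply: vgeM; first exact: vge_const.
by rewrite vgeE ?expf_neq0 // vintX.
Qed.

Lemma val_alg_inf P (c : ratfun k) : vint P t < 0 ->
  P c%:A = (`|vint P t|%N%:Z%:E * - rdeg c)%E.
Proof.
move=> Pt; have [->|c0] := eqVneq c 0.
  by rewrite scale0r val0 rdeg0 /= gt0_muley // lte_fin; lia.
have [a [b [a0 b0 cE]]] := ratfun_frac c0; clear c0.
have pa0 : pol F a != 0 by rewrite pol_eq0.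
have pb0 : pol F b != 0 by rewrite pol_eq0.
have cF : (c%:A : F) = pol F a / pol F b.
  by apply: (mulIf pb0); rewrite mulfVK // /pol -algM cE.
rewrite (rdeg_frac a0 b0 cE) cF valE ?mulf_neq0 ?invr_eq0 //.
rewrite vintM ?invr_eq0 // vintV // (vint_pol_inf Pt a0) (vint_pol_inf Pt b0).
rewrite -EFinN -EFinM; congr (_%:E).
have := size_poly_gt0 a; have := size_poly_gt0 b; rewrite a0 b0.
move: (size a) (size b) => u v; nia.
Qed.

Lemma infinite_placesP P : infinite_places P <-> vint P t < 0.
Proof.
have cX : ('X : {poly k}) != 0 by rewrite polyX_eq0.
have rV : rdeg ((tofrac ('X : {poly k}))^-1) = (-1)%:E.
  rewrite (@rdeg_frac _ _ 1 'X) ?oner_eq0 //.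
    by rewrite size_polyX size_poly1.
  by rewrite mulVf ?tofrac1 ?tofrac_eq0.
split => [Pinf|Pt].
  have : P_infty (tofrac ('X : {poly k}))^-1.
    by rewrite /P_infty /= rV.
  rewrite -Pinf /= algV -/(pol F 'X) valE ?invr_eq0 // lte_fin vintV //.
  by rewrite oppr_gt0.
have e_gt0 : (0 < `|vint P t|%N)%N by lia.
rewrite /infinite_places; apply/seteqP; split => c; rewrite /P_infty /= val_alg_inf //;
  rewrite /rdeg; case: ifP => _.
- by [].
- by rewrite -EFinN -EFinM !lte_fin; nia.
- by rewrite /= gt0_muley // lte_fin.
- by rewrite -EFinN -EFinM !lte_fin; nia.
Qed.

Lemma ram_indexP P : infinite_places P ->
  (0 < ram_index P)%N /\ forall c : ratfun k, P c%:A = ((ram_index P)%:Z%:E * - rdeg c)%E.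
Proof.
move=> /infinite_placesP Pt.
have ramP : forall c : ratfun k, P c%:A = ((ram_index P)%:Z%:E * - rdeg c)%E.
  rewrite /ram_index; case: xgetP => [e _ //|/(_ `|vint P t|%N) /= ne].
  by case: ne => c; exact: val_alg_inf.
split => //; rewrite lt0n; apply/eqP => e0.
have := ramP (tofrac 'X); rewrite e0 mul0e -/(pol F 'X) valE // => -[vt0].
by rewrite vt0 in Pt.
Qed.

Lemma vint_t_inf P : infinite_places P -> vint P t = - (ram_index P)%:Z.
Proof.
move=> /ram_indexP[_ /(_ (tofrac 'X))].
rewrite (@rdeg_frac _ _ 'X 1) ?oner_eq0 ?polyX_eq0 ?mulr1 ?tofrac1 ?mulr1 //.
by rewrite size_polyX size_poly1 -/(pol F 'X) valE // => -[->]; rewrite mulrN mulr1.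
Qed.

Lemma finite_placesP P : finite_places P <-> 0 <= vint P t.
Proof.
by rewrite leNgt; split => [nP|/negP nP]; [apply/negP|] => /infinite_placesP.
Qed.

Lemma vge_pol_fin P a : finite_places P -> vge P 0 (pol F a).
Proof.
move=> /finite_placesP Pt; rewrite polE; apply: vge_sum => i _.
by apply: vge0M; [exact: vge_const | apply: vge0X; rewrite vgeE].
Qed.

End InfinitePlaces.

(** * Finiteness of zeros *)

Section GlobalPlaces.
Variables (k : fieldType) (F : fieldExtType (ratfun k)).
Implicit Types (P Q : place F) (x y z : F) (a b f g p : {poly k}).

Local Notation t := (pol F 'X).

Let t0 : t != 0. Proof. by rewrite pol_eq0 polyX_eq0. Qed.

Lemma equivalent_places_finite (A : set (place F)) :
  (forall P Q (c : ratfun k), A P -> A Q -> vge P 0 c%:A -> vge Q 0 c%:A) ->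
  finite_set A.
Proof.
move=> eqA; apply: contrapT => /(infinite_set_fset (\dim {:F}).+1)[s sA dims].
have := @equivalent_places_bound _ F (finmap.enum_fset s) (finmap.fset_uniq s).
move=> bound; suff : (size (finmap.enum_fset s) <= \dim {:F})%N by rewrite leqNgt dims.
by apply: bound => P Q c Ps Qs; apply: eqA; exact: sA.
Qed.

Lemma finite_infinite_places : finite_set (@infinite_places k F).
Proof.
apply: equivalent_places_finite => P Q c /ram_indexP[eP cP] /ram_indexP[eQ cQ].
rewrite /vge /= cP cQ /rdeg; case: ifP => _.
  by move=> _; rewrite /= gt0_muley ?leey // lte_fin ltz_nat.
by rewrite -!EFinN -!EFinM !lee_fin; nia.
Qed.

(** A proper factorisation of f reduces the claim to factors of smaller degree. If
    f is irreducible, all places at which f vanishes induce the f-adic valuation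
    on k(t). *)
Lemma finite_zeros f : f != 0 ->
  finite_set [set P | finite_places P /\ vge P 1 (pol F f)].
Proof.
have [N] := ubnP (size f); elim: N f => // N IH f leN f0.
have pf0 : pol F f != 0 by rewrite pol_eq0.
have [irr|nirr] := pselect (irreducible_poly f).
  apply: equivalent_places_finite.
  have vint_coprime P a : finite_places P -> vge P 1 (pol F f) -> ~~ (f %| a) ->
      pol F a != 0 /\ vint P (pol F a) = 0.
    move=> Pfin Pf fa.
    have /Bezout_eq1_coprimepP[[u w] /= uw] : coprimep f a.
      by rewrite irreducible_poly_coprime.
    have a0 : pol F a != 0.
      by rewrite pol_eq0; apply: contraNneq fa => ->; exact: dvdp0.
    split => //; apply/eqP; rewrite eq_le; apply/andP; split; last first.
      by rewrite -(vgeE P 0 a0); exact: vge_pol_fin.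
    rewrite leNgt; apply/negP => a_gt0.
    have : vge P 1 (pol F 1).
      rewrite -uw rmorphD !rmorphM; apply: vgeD.
        rewrite -[X in vge _ X](add0r 1); apply: vgeM => //; exact: vge_pol_fin.
      rewrite -[X in vge _ X](add0r 1); apply: vgeM; first exact: vge_pol_fin.
      by rewrite vgeE.
    by rewrite rmorph1 vgeE ?oner_neq0 // vint1.
  have sign P c : finite_places P -> vge P 1 (pol F f) -> (c%:A : F) != 0 ->
      exists j : int, forall Q, finite_places Q -> vge Q 1 (pol F f) ->
         vge Q 0 c%:A <-> 0 <= j.
    move=> Pfin Pf c0; have [j [a [b [fa fb cE]]]] := alg_valuation irr.1 c0.
    exists j => Q Qfin Qf.
    have [a0 va] := vint_coprime Q a Qfin Qf fa.
    have [b0 vb] := vint_coprime Q b Qfin Qf fb.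
    move: Qf; rewrite cE !vgeE ?mulf_neq0 ?invr_eq0 ?expfz_neq0 //.
    rewrite !vintM ?mulf_neq0 ?invr_eq0 ?expfz_neq0 // vintV // va vb vintXz //.
    by move=> Qf; split; nia.
  move=> P Q c [Pfin Pf] [Qfin Qf].
  have [->|c0] := eqVneq (c%:A : F) 0; first by move=> _; exact: vge0.
  have [j jP] := sign P c Pfin Pf c0.
  by rewrite (propext (jP P Pfin Pf)) (propext (jP Q Qfin Qf)).
have [f1|f1] := leqP (size f) 1.
  rewrite (_ : [set _ | _] = set0) //; apply/seteqP; split => // P [_].
  rewrite vgeE // (size1_polyC f1); have := vint_const P f`_0.
  by rewrite -/(pol F _) => ->.
have [q [sq qf nqf]] : exists q : {poly k}, [/\ size q != 1, q %| f & ~~ (q %= f)].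
  apply: contrapT => none; apply: nirr; split => // q sq qf.
  by apply: contrapT => /negP nqf; apply: none; exists q.
have fE := divpK qf.
have q0 : q != 0 by apply: contraNneq f0 => q0; rewrite -fE q0 mulr0.
have h0 : f %/ q != 0 by apply: contraNneq f0 => h0; rewrite -fE h0 mul0r.
have sqf : (size q < size f)%N.
  by rewrite ltn_neqAle dvdp_leq // andbT; apply: contra nqf; rewrite dvdp_size_eqp.
have shf : (size (f %/ q)%R < size f)%N.
  rewrite size_divp // ltn_subrL size_poly_gt0 f0 andbT -ltnS prednK ?size_poly_gt0 //.
  by rewrite ltn_neqAle eq_sym sq size_poly_gt0.
have fin1 := IH q (leq_trans sqf leN) q0.
have fin2 := IH (f %/ q) (leq_trans shf leN) h0.
have fin12 : finite_set ([set P | finite_places P /\ vge P 1 (pol F q)] `|`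
    [set P | finite_places P /\ vge P 1 (pol F (f %/ q))]) by rewrite finite_setU.
apply: sub_finite_set fin12 => P [Pfin Pf].
have pq0 : pol F q != 0 by rewrite pol_eq0.
have ph0 : pol F (f %/ q) != 0 by rewrite pol_eq0.
have := vge_pol_fin q Pfin; have := vge_pol_fin (f %/ q) Pfin.
have : 1 <= vint P (pol F (f %/ q)) + vint P (pol F q).
  by rewrite -vintM // -rmorphM fE -(vgeE _ _ pf0).
rewrite !vgeE //; case: (lerP 1 (vint P (pol F q))) => [v1 _ _ _|v1 hq _ _].
  by left; split => //; rewrite vgeE.
by right; split => //; rewrite vgeE //; lia.
Qed.

Lemma int_closureE (S : set (ratfun k)) :
  @int_closure k F S = integral [set c%:A | c in S].
Proof.
apply/seteqP; split => x [p [pm pS px]].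
  exists (map_poly (in_alg F) p); split => //; first by rewrite map_monic.
  by move=> i; rewrite coef_map; exists p`_i.
have /choice[c cP] : forall i, exists c, S c /\ c%:A = p`_i.
  by move=> i; have [c Sc cE] := pS i; exists c.
pose q := \poly_(i < size p) c i.
have qE : map_poly (in_alg F) q = p.
  apply/polyP => i; rewrite coef_map coef_poly; case: ltnP => [_|pi].
    by have [_ <-] := cP i.
  by rewrite raddf0 nth_default.
exists q; split; [|move=> i|by rewrite qE].
  by rewrite -(map_monic (in_alg F)) qE.
have [Sc cE] := cP i; rewrite coef_poly; case: ltnP => // pi.
have c0 : c i = 0 by apply/eqP; rewrite -(alg_eq0 F) cE nth_default.
by rewrite -c0.
Qed.

End GlobalPlaces.

(** * Integral closures and intersections of valuation rings *)

Section IntegralClosures.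
Variables (k : fieldType) (F : fieldExtType (ratfun k)).
Implicit Types (P Q : place F) (x y z : F) (a b f g p : {poly k}).

Local Notation t := (pol F 'X).
Local Notation fin_places := (@finite_places k F).
Local Notation inf_places := (@infinite_places k F).

Let t0 : t != 0. Proof. by rewrite pol_eq0 polyX_eq0. Qed.

Definition vset (S : set (place F)) (a : place F -> int) : set F :=
  [set x | forall P, S P -> vge P (a P) x].

Lemma subring_image (A : set (ratfun k)) : A 1 ->
  (forall c d, A c -> A d -> A (c - d)) -> (forall c d, A c -> A d -> A (c * d)) ->
  subring [set (c%:A : F) | c in A].
Proof.
move=> A1 AB AM; split => [|_ _ [c Ac <-] [d Ad <-]|_ _ [c Ac <-] [d Ad <-]].
- by exists 1 => //; rewrite scale1r.
- by exists (c - d); [exact: AB | rewrite scalerBl].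
- by exists (c * d); [exact: AM | rewrite algM].
Qed.

Lemma int_closure_polys : @int_closure k F polys = vset fin_places (fun=> 0).
Proof.
rewrite int_closureE; apply/seteqP; split => x.
  move=> xint P Pfin; apply: integral_vge xint => _ [_ [a ->] <-].
  exact: vge_pol_fin.
move=> xP; apply: contrapT => /place_exists[||P [PA]].
- apply: subring_image => [|_ _ [a ->] [b ->]|_ _ [a ->] [b ->]].
  + by exists 1; rewrite tofrac1.
  + by exists (a - b); rewrite tofracB.
  + by exists (a * b); rewrite tofracM.
- by move=> c; exists (tofrac c%:P) => //; exists c%:P.
apply; apply: xP; apply/finite_placesP; rewrite -(vgeE _ _ t0); apply: PA.
by exists (tofrac 'X) => //; exists 'X.
Qed.

Lemma A_inftyP (c : ratfun k) : A_infty c <->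
  exists a b, [/\ b != 0, (size a <= size b)%N & c * tofrac b = tofrac a].
Proof.
split => [|[a [b [b0 sab cE]]]].
  have [->|c0] := eqVneq c 0.
    by move=> _; exists 0, 1; rewrite oner_eq0 size_poly0 mul0r tofrac0.
  have [a [b [a0 b0 cE]]] := ratfun_frac c0.
  rewrite /A_infty /= (rdeg_frac a0 b0 cE) lee_fin subr_le0 lez_nat => sab.
  by exists a, b.
have [a0|a0] := eqVneq a 0.
  have -> : c = 0.
    apply/eqP; move/eqP: cE; rewrite a0 tofrac0 mulf_eq0 tofrac_eq0 (negPf b0).
    by rewrite orbF.
  by rewrite /A_infty /= rdeg0.
by rewrite /A_infty /= (rdeg_frac a0 b0 cE) lee_fin subr_le0 lez_nat.
Qed.

Lemma A_infty_subring : subring [set (c%:A : F) | c in A_infty].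
Proof.
apply: subring_image => [|c d|c d].
- by apply/A_inftyP; exists 1, 1; rewrite oner_eq0 mul1r.
- move=> /A_inftyP[a [b [b0 sab cE]]] /A_inftyP[a' [b' [b'0 sab' dE]]].
  apply/A_inftyP; exists (a * b' - a' * b), (b * b'); split.
  + by rewrite mulf_neq0.
  + apply: leq_trans (size_polyD _ _) _; rewrite size_polyN geq_max.
    rewrite !(leq_trans (size_polyMleq _ _)) // size_mul // -!subn1 leq_sub2r //.
      by rewrite [(_ + size b)%N]addnC leq_add2l.
    by rewrite leq_add2r.
  + by rewrite tofracB !tofracM -cE -dE; ring.
- move=> /A_inftyP[a [b [b0 sab cE]]] /A_inftyP[a' [b' [b'0 sab' dE]]].
  apply/A_inftyP; exists (a * a'), (b * b'); split.
  + by rewrite mulf_neq0.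
  + rewrite (leq_trans (size_polyMleq _ _)) // size_mul // -!subn1 leq_sub2r //.
    exact: leq_add.
  + by rewrite !tofracM -cE -dE; ring.
Qed.

(** A place that is nonnegative on A_infty lies over P_infty: otherwise t would be
    a unit there, and with it every nonzero polynomial, so that all elements of
    k(t), hence of F, would be integral at P. *)
Lemma int_closure_A_infty : @int_closure k F A_infty = vset inf_places (fun=> 0).
Proof.
rewrite int_closureE; apply/seteqP; split => x.
  move=> xint P /ram_indexP[e_gt0 ramP]; apply: integral_vge xint => _ [c cA <-].
  move: cA; rewrite /vge /A_infty /= ramP /rdeg; case: ifP => _.
    by rewrite /= gt0_muley ?leey // lte_fin.
  by rewrite -EFinN -EFinM !lee_fin; nia.
move=> xP; apply: contrapT => /place_exists[||P [PA]].
- exact: A_infty_subring.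
- move=> c; exists (tofrac c%:P) => //; apply/A_inftyP; exists c%:P, 1.
  by rewrite oner_eq0 size_poly1 size_polyC leq_b1 tofrac1 mulr1.
apply; apply: xP; apply/infinite_placesP; rewrite ltNge; apply/negP => Pt.
have [y y0 yP] := val_surj P (-1).
have : vge P 0 y; last by rewrite vgeE // yP.
apply: integral_vge (algebraic_over_ratfun y) => _ [c _ <-].
have [a [b [b0 ->]]] := alg_frac F c.
have pb0 : pol F b != 0 by rewrite pol_eq0.
apply: vge0M; first by apply: vge_pol_fin; exact/finite_placesP.
have tX0 : tofrac ('X : {poly k}) != 0 by rewrite tofrac_eq0 polyX_eq0.
have tV : vge P 0 t^-1.
  apply: PA; exists (tofrac 'X)^-1; last by rewrite algV.
  apply/A_inftyP; exists 1, 'X; rewrite polyX_eq0 size_polyX size_poly1.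
  by split => //; rewrite mulVf.
have : vge P 0 (t ^+ (size b).-1 / pol F b).
  apply: PA; exists (tofrac ('X^((size b).-1)) / tofrac b).
    apply/A_inftyP; exists 'X^((size b).-1), b; split => //.
      by rewrite size_polyXn prednK // size_poly_gt0.
    by apply: mulfVK; rewrite tofrac_eq0.
  by rewrite algM algV; congr (_ / _); exact: (rmorphXn (pol F)).
rewrite !vgeE ?mulf_neq0 ?invr_eq0 ?expf_neq0 // in tV *.
rewrite vintM ?invr_eq0 ?expf_neq0 // vintX //; move: tV; rewrite vintV //.
by nia.
Qed.

(** The element t is transcendental over k, so it has a pole. *)
Lemma infinite_place_exists : exists P, inf_places P.
Proof.
pose A := [set pol F c%:P | c in [set: k]].
have [|||P [_ Pt]] := @place_exists _ F A t.
- split => [|_ _ [c _ <-] [d _ <-]|_ _ [c _ <-] [d _ <-]].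
  + by exists 1 => //; rewrite rmorph1.
  + by exists (c - d) => //; rewrite polyCB rmorphB.
  + by exists (c * d) => //; rewrite polyCM rmorphM.
- by move=> c; exists c.
- move=> [p [pm pA]].
  have /choice[c cP] : forall i, exists c, pol F c%:P = p`_i.
    by move=> i; have [c _ cE] := pA i; exists c.
  have -> : root p t = (\poly_(i < size p) c i == 0).
    rewrite -(pol_eq0 F) rootE horner_coef poly_def rmorph_sum; congr (_ == 0).
    by apply: eq_bigr => i _; rewrite -cP -mul_polyC rmorphM rmorphXn.
  move=> /eqP/polyP/(_ (size p).-1); rewrite coef0 coef_poly prednK; last first.
    by rewrite size_poly_gt0 monic_neq0.
  rewrite leqnn => c0; have := cP (size p).-1; rewrite c0 polyC0 rmorph0.
  by rewrite -lead_coefE (monicP pm) => /eqP; rewrite eq_sym oner_eq0.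
by exists P; apply/infinite_placesP; rewrite ltNge; apply/negP; rewrite -(vgeE _ _ t0).
Qed.

(** An element x without poles is algebraic over k. If x is nonzero, an equation for
    it can be chosen with a nonzero constant term, which is a polynomial multiple
    of x; but a nonzero constant has no zeros. *)
Lemma no_poles_eq0 x P0 : (forall P, vge P 0 x) -> vge P0 1 x -> x = 0.
Proof.
move=> xP xP0; apply/eqP; apply: contrapT => /negP x0.
pose A := [set pol F c%:P | c in [set: k]].
have algA (p : {poly F}) : coefs_in A p -> p != 0 -> ~ root p x.
  elim/poly_ind: p => [_|p c IH pA pc0]; first by rewrite eqxx.
  have pA' : coefs_in A p.
    by move=> i; have := pA i.+1; rewrite coefD coefMX coefC addr0.
  have pxP : vge P0 1 (p.[x] * x).
    rewrite -[X in vge _ X](add0r 1); apply: vgeM => //; rewrite horner_coef.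
    apply: vge_sum => i _; apply: vge0M; last exact: vge0X.
    by have [d _ <-] := pA' i; exact: vge_const.
  have cA : A c by have := pA 0%N; rewrite coefD coefMX coefC add0r.
  rewrite rootE !hornerE => /eqP sum0.
  have [c0|c0] := eqVneq c 0.
    move: sum0; rewrite c0 addr0 => /eqP; rewrite mulf_eq0 (negPf x0) orbF.
    apply: IH => //; apply: contra_neq pc0 => ->.
    by rewrite mul0r add0r c0.
  have : vge P0 1 c.
    have -> : c = - (p.[x] * x) by apply/eqP; rewrite -addr_eq0 addrC sum0.
    exact: vgeN.
  by rewrite vgeE //; case: cA => d _ <-; rewrite vint_const.
have [|||P [_ []//]] := @place_exists _ F A x.
- split => [|_ _ [c _ <-] [d _ <-]|_ _ [c _ <-] [d _ <-]].
  + by exists 1 => //; rewrite rmorph1.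
  + by exists (c - d) => //; rewrite polyCB rmorphB.
  + by exists (c * d) => //; rewrite polyCM rmorphM.
- by move=> c; exists c.
- by move=> [p [pm pA px]]; exact: (algA p pA (monic_neq0 pm) px).
Qed.

(** If d is a common denominator of the coefficients of a monic equation for x of
    degree m, then d x satisfies the equation with coefficients p_i d ^+ (m - i). *)
Lemma denominator x : exists2 a, a != 0 & vset fin_places (fun=> 0) (pol F a * x).
Proof.
have [p [pm pK px]] := algebraic_over_ratfun x.
have /choice[b bP] : forall i, exists b, b != 0 /\ exists a, p`_i * pol F b = pol F a.
  move=> i; have [c _ <-] := pK i; have [a [b [b0 ->]]] := alg_frac F c.
  by exists b; split => //; exists a; rewrite mulfVK // pol_eq0.
have [m sp] : exists m, size p = m.+1.
  by exists (size p).-1; rewrite prednK // size_poly_gt0 monic_neq0.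
pose d := \prod_(i < m) b i; have d0 : d != 0 by apply/prodf_neq0 => i _; case: (bP i).
have pd (i : 'I_m) : exists a, p`_i * pol F d = pol F a.
  have [_ [a aE]] := bP i; exists (a * \prod_(j < m | j != i) b j).
  by rewrite /d (bigD1 i) //= !rmorphM mulrA aE.
exists d => // P Pfin; apply: (valuation_subring_closed (place_valuation_subring P)).
pose q := \poly_(i < m) (p`_i * pol F d ^+ (m - i)).
exists ('X^m + q); split.
- by rewrite monicE lead_coefDl ?lead_coefXn // size_polyXn ltnS size_poly.
- move=> i; rewrite coefD coefXn; apply: vgeD.
    case: eqP => _; last exact: vge0.
    by rewrite vgeE ?oner_eq0 // vint1.
  rewrite coef_poly; case: ltnP => [im|_]; last exact: vge0.
  have [a aE] := pd (Ordinal im).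
  rewrite -subnSK // exprS mulrA aE; apply: vge0M; first exact: vge_pol_fin.
  by apply: vge0X; exact: vge_pol_fin.
- move: px; rewrite !rootE horner_coef sp big_ord_recr /=.
  have -> : p`_m = 1 by move/monicP: pm; rewrite lead_coefE sp.
  rewrite mul1r hornerD hornerXn horner_poly => /eqP px.
  have -> : \sum_(i < m) p`_i * pol F d ^+ (m - i) * (pol F d * x) ^+ i =
      pol F d ^+ m * \sum_(i < m) p`_i * x ^+ i.
    rewrite mulr_sumr; apply: eq_bigr => i _; rewrite exprMn mulrACA -mulrA.
    rewrite [RHS]mulrCA; congr (_ * _).
    by rewrite mulrA -exprD subnKC // ltnW.
  by rewrite exprMn -mulrDr addrC px mulr0.
Qed.

End IntegralClosures.

(** * Strong approximation *)

Section StrongApproximation.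
Variables (k : fieldType) (F : fieldExtType (ratfun k)).
Implicit Types (P Q : place F) (x y z : F) (a b f g p : {poly k}) (S : set (place F)).

Local Notation t := (pol F 'X).
Local Notation fin_places := (@finite_places k F).
Local Notation inf_places := (@infinite_places k F).

Let t0 : t != 0. Proof. by rewrite pol_eq0 polyX_eq0. Qed.

(** T' is required to be the zero set of an element f integral on S because powers of
    f then have arbitrarily high zeros on T' and no others in S. *)
Definition strong_approximation S := forall T : seq (place F),
  exists (f : F) (T' : seq (place F)),
  [/\ f != 0, vset S (fun=> 0) f, forall P, S P -> (P \in T') <-> vge P 1 f,
      (forall P, P \in T' -> S P) /\ (forall P, S P -> P \in T -> P \in T')
    & forall (x : place F -> F) (m : int), exists w,
        (forall P, P \in T' -> vge P m (w - x P)) /\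
        (forall P, S P -> P \notin T' -> vge P 0 w)].

Lemma strong_approximation_inf : strong_approximation inf_places.
Proof.
have [T' T'E] : exists T' : seq (place F), uniq T' /\ forall P, (P \in T') = `[< inf_places P >].
  exists (finmap.enum_fset (fset_set inf_places)); split; first exact: finmap.fset_uniq.
  move=> P; rewrite [LHS](in_fset_set (finite_infinite_places F)).
  by apply/idP/asboolP; rewrite inE.
have [uT' memT'] := T'E.
have tP P : inf_places P -> vge P 1 t^-1.
  move/infinite_placesP => Pt; rewrite vgeE ?invr_eq0 // vintV //; lia.
move=> T; exists t^-1, T'; split.
- by rewrite invr_eq0.
- by move=> P /tP; exact: vgeW.
- by move=> P PS; rewrite memT'; split => [_|_]; [exact: tP | exact/asboolP].
- by split => [P|P PS _]; rewrite memT'; [move/asboolP | exact/asboolP].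
move=> x m; have [w wP] := weak_approximation x m uT'; exists w; split => // P PS.
by rewrite memT' => /asboolP.
Qed.

(** A valuation trivial on k(t) would be nonnegative on its algebraic extension F. *)
Lemma finite_place_poly P : finite_places P -> exists2 f, f != 0 & vge P 1 (pol F f).
Proof.
move=> Pfin; apply: contrapT => none.
have vpol f : f != 0 -> vint P (pol F f) = 0.
  move=> f0; have pf0 : pol F f != 0 by rewrite pol_eq0.
  have := vge_pol_fin f Pfin; rewrite vgeE // => f_ge0.
  apply/eqP; rewrite eq_le f_ge0 andbT leNgt; apply/negP => f_gt0.
  by apply: none; exists f => //; rewrite vgeE.
have [y y0 yP] := val_surj P (-1).
have : vge P 0 y; last by rewrite vgeE // yP.
apply: integral_vge (algebraic_over_ratfun y) => _ [c _ <-].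
have [a [b [b0 ->]]] := alg_frac F c.
apply: vge0M; first exact: vge_pol_fin.
have pb0 : pol F b != 0 by rewrite pol_eq0.
by rewrite vgeE ?invr_eq0 // vintV // vpol.
Qed.

(** Weak approximation on the zeros of f may introduce poles elsewhere; write
    their denominator as g h with g supported on the zeros of f and h prime to
    f. Then a multiple of h congruent to 1 modulo a power of f removes them. *)
Lemma strong_approximation_fin : strong_approximation fin_places.
Proof.
move=> T.
have /choice[h hP] : forall P, exists h, h != 0 /\ (finite_places P -> vge P 1 (pol F h)).
  move=> P; have [Pfin|nfin] := pselect (finite_places P); last by exists 1; rewrite oner_neq0.
  by have [h h0 hP] := finite_place_poly Pfin; exists h.
pose f := \prod_(P <- T) h P.
have f0 : f != 0 by rewrite prodf_seq_neq0; apply/allP => P _; case: (hP P).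
have pf0 : pol F f != 0 by rewrite pol_eq0.
have Tf P : finite_places P -> P \in T -> vge P 1 (pol F f).
  move=> Pfin PT; rewrite /f (big_rem P) //= rmorphM.
  rewrite -[X in vge _ X](addr0 1); apply: vgeM; last exact: vge_pol_fin.
  by case: (hP P) => _; apply.
have [T' [uT' T'P]] : exists T' : seq (place F), uniq T' /\
    forall P, (P \in T') <-> finite_places P /\ vge P 1 (pol F f).
  exists (finmap.enum_fset (fset_set [set P | finite_places P /\ vge P 1 (pol F f)])).
  split; first exact: finmap.fset_uniq.
  by move=> P; rewrite [X in is_true X](in_fset_set (finite_zeros F f0)) inE.
exists (pol F f), T'; split => //.
- by move=> P Pfin; exact: vge_pol_fin.
- by move=> P Pfin; split => [/T'P[]//|Pf]; apply/T'P.
- by split => [P /T'P[]//|P Pfin PT]; apply/T'P; split => //; exact: Tf.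
move=> x m; have [w0 w0P] := weak_approximation x m uT'.
have [a a0 aw] := denominator w0.
pose M := (\sum_(P <- T') `|m - vint P w0|)%N.
pose u := gdcop f a.
have cop : coprimep u (f ^+ M.+1).
  by rewrite coprimep_sym coprimep_expl // coprimep_sym coprimep_gdco.
have [[c e] /= ce] := Bezout_eq1_coprimepP _ _ cop.
exists (pol F (c * u) * w0); split => [P PT'|P Pfin PT'].
  have [Pfin Pf] := (T'P P).1 PT'.
  have -> : pol F (c * u) * w0 - x P = (w0 - x P) - pol F (e * f ^+ M.+1) * w0.
    have -> : pol F (c * u) = 1 - pol F (e * f ^+ M.+1).
      by rewrite -[1](rmorph1 (pol F)) -ce rmorphD addrK.
    by ring.
  apply: vgeB; first exact: w0P.
  apply: (@vgeW _ _ _ _ (M.+1%:Z + vint P w0)).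
    by rewrite /M (big_rem P) //=; lia.
  apply: vgeM; last exact: vge_vint.
  rewrite rmorphM -[X in vge _ X]add0r; apply: vgeM; first exact: vge_pol_fin.
  rewrite rmorphXn vgeE ?expf_neq0 // vintX //; move: Pf; rewrite vgeE //.
  by move: (vint P _) (M) => v n; nia.
pose N := size a; have /dvdpP[q qE] : a %| f ^+ N * u.
  by rewrite mulrC; exact: dvdp_gdcor.
have aE : f ^+ N * u = q * a by [].
have Pf : vint P (pol F f) = 0.
  have := vge_pol_fin f Pfin; rewrite vgeE // => f_ge0.
  apply/eqP; rewrite eq_le f_ge0 andbT leNgt; apply/negP => f_gt0.
  by case/negP: PT'; apply/T'P; split => //; rewrite vgeE.
rewrite rmorphM -mulrA; apply: vge0M; first exact: vge_pol_fin.
have fN0 : pol F f ^- N != 0 by rewrite invr_eq0 expf_neq0.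
have paE : pol F f ^+ N * pol F u = pol F q * pol F a.
  by rewrite -rmorphXn -!rmorphM aE.
have -> : pol F u * w0 = pol F f ^- N * (pol F q * (pol F a * w0)).
  apply: (mulfI (expf_neq0 N pf0)); rewrite mulVKf ?expf_neq0 //.
  transitivity (pol F f ^+ N * pol F u * w0); first by rewrite mulrA.
  by rewrite paE mulrA.
apply: vge0M; first by rewrite vgeE // vintV ?expf_neq0 // vintX // Pf mul0r.
by apply: vge0M; [exact: vge_pol_fin | exact: aw].
Qed.

End StrongApproximation.

(** * Fractional ideals as valuation sets *)

Section IdealsAsValuationSets.
Variables (k : fieldType) (F : fieldExtType (ratfun k)).
Implicit Types (P Q : place F) (x y z : F) (a b : place F -> int).
Variables (S : set (place F)) (saS : strong_approximation S).

Local Notation O := (vset S (fun=> 0)).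

Definition finsupp_on a := exists T : seq (place F), forall P, S P -> P \notin T -> a P = 0.

Definition single P (m : int) : place F -> int := fun Q => if Q == P then m else 0.

Lemma finsupp_single P m : finsupp_on (single P m).
Proof. by exists [:: P] => Q _; rewrite inE /single => /negPf ->. Qed.

Lemma eq_vset a b : (forall P, S P -> a P = b P) -> vset S a = vset S b.
Proof.
by move=> ab; apply/seteqP; split => x xP P PS; have := xP P PS; rewrite ab.
Qed.

(** It suffices to write 1 = x w + y u with x and y in the ideal of a, w and u in the
    ideal of - a. Take x of exact valuation a at the zeros of f, y a high power of
    f, and w an approximation of 1/x at the zeros of f. *)
Lemma vset_mul a b : finsupp_on a ->
  ideal_mul (vset S a) (vset S b) = vset S (fun P => a P + b P).
Proof.
move=> [T aT]; apply/seteqP; split => [_ [s [sab ->]] P PS|z zab].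
  rewrite big_seq; apply: vge_sum => u /sab[ua ub].
  by apply: vgeM; [exact: ua | exact: ub].
have [f [T' [f0 fS T'f [T'S TT'] approx]]] := saS T.
pose M := (\sum_(P <- T') `|a P|)%N.
have aM P : P \in T' -> (`|a P| <= M)%N by move=> PT; rewrite /M (big_rem P) //=; lia.
have a0 P : S P -> P \notin T' -> a P = 0.
  by move=> PS PT'; apply: aT => //; apply: contra PT'; exact: TT'.
have fT' P : P \in T' -> 1 <= vint P f.
  by move=> PT'; rewrite -(vgeE _ _ f0); apply/T'f => //; exact: T'S.
have f0S P : S P -> P \notin T' -> vint P f = 0.
  move=> PS PT'; have := fS P PS; rewrite vgeE // => f_ge0.
  apply/eqP; rewrite eq_le f_ge0 andbT leNgt; apply/negP => f_gt0.
  by case/negP: PT'; apply/T'f => //; rewrite vgeE.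
have /choice[e eP] : forall P, exists e, e != 0 /\ vint P e = a P.
  by move=> P; have [e e0 eP] := val_surj P (a P); exists e.
have [x [xT' xS]] := approx e M.+1%:Z.
have xa P : P \in T' -> x != 0 /\ vint P x = a P.
  move=> PT'; have [e0 <-] := eP P; rewrite -[x](subrK (e P)) addrC.
  apply: vint_dom => //; apply: vgeW (xT' P PT'); rewrite (eP P).2.
  by have := aM P PT'; lia.
pose y := f ^+ M.
have y0 : y != 0 by rewrite expf_neq0.
have vy P : vint P y = vint P f * M%:Z by rewrite vintX.
pose N := (\sum_(P <- T') (`|vint P y| + 2 * `|a P|))%N.
have yN P : P \in T' -> (`|vint P y| + 2 * `|a P| <= N)%N.
  by move=> PT; rewrite /N (big_rem P) //=; lia.
have [w [wT' wS]] := approx (fun=> x^-1) N%:Z.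
pose u := (1 - x * w) / y.
have xwyu : 1 = x * w + y * u by rewrite /u mulrCA mulfV // mulr1 addrC subrK.
have xA : vset S a x.
  move=> P PS; have [PT'|PT'] := boolP (P \in T'); last by rewrite a0 //; exact: xS.
  by have [_ <-] := xa P PT'; exact: vge_vint.
have yA : vset S a y.
  move=> P PS; rewrite vgeE // vy; have [PT'|PT'] := boolP (P \in T').
    by have := aM P PT'; have := fT' P PT'; nia.
  by rewrite a0 // f0S.
have wA : vset S (fun P => - a P) w.
  move=> P PS; have [PT'|PT'] := boolP (P \in T'); last first.
    by rewrite a0 // oppr0; exact: wS.
  have [x0 vx] := xa P PT'.
  rewrite -[w](subrK x^-1); apply: vgeD.
    by apply: vgeW (wT' P PT'); have := yN P PT'; lia.
  by rewrite vgeE ?invr_eq0 // vintV // vx.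
have uA : vset S (fun P => - a P) u.
  move=> P PS; have [PT'|PT'] := boolP (P \in T').
    have [x0 vx] := xa P PT'.
    have -> : u = - (x * (w - x^-1)) * y^-1 by rewrite /u mulrBr mulfV // opprB.
    apply: (@vgeW _ _ _ _ (a P + N%:Z + - vint P y)).
      by have := yN P PT'; lia.
    apply: vgeM; last by rewrite vgeE ?invr_eq0 // vintV.
    by apply: vgeN; apply: vgeM; [rewrite -vx; exact: vge_vint | exact: wT'].
  rewrite a0 // oppr0 /u; apply: vge0M; last first.
    by rewrite vgeE ?invr_eq0 // vintV // vy f0S.
  apply: vgeB; first by rewrite vgeE ?oner_eq0 // vint1.
  by apply: vge0M; [exact: xS | exact: wS].
clearbody u; have toB v : vset S (fun P => - a P) v -> vset S b (v * z).
  move=> vA P PS; have -> : b P = - a P + (a P + b P) by rewrite addKr.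
  by apply: vgeM; [exact: vA | exact: zab].
exists [:: (x, w * z); (y, u * z)]; split.
  move=> v; rewrite !inE => /orP[]/eqP-> /=; split => //; exact: toB.
by rewrite !big_cons big_nil addr0 /= !mulrA -mulrDl -xwyu mul1r.
Qed.

(** With 1 = sum of u_i v_i in the product of the ideals of a and - a, an element x
    of the inverse is the sum of the (x u_i) v_i. *)
Lemma vset_inv a : finsupp_on a ->
  ideal_inv O (vset S a) = vset S (fun P => - a P).
Proof.
move=> fa; apply/seteqP; split => x xP; last first.
  by move=> y ya P PS; rewrite -(addNr (a P)); apply: vgeM; [exact: xP | exact: ya].
have : ideal_mul (vset S a) (vset S (fun P => - a P)) 1.
  rewrite vset_mul // => P PS; rewrite subrr; apply: vgeW (vge_vint P 1).
  by rewrite vint1.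
move=> [s [sa s1]] P PS; rewrite -[x]mulr1 s1 mulr_sumr big_seq; apply: vge_sum.
move=> u us; have [ua ub] := sa u us.
rewrite mulrA -[X in vge _ X]add0r; apply: vgeM; last exact: ub.
exact: (xP u.1 ua).
Qed.

Lemma vset_iter a n : finsupp_on a ->
  iter n (ideal_mul (vset S a)) O = vset S (fun P => a P *+ n).
Proof.
move=> fa; elim: n => [|n IH] //=.
by rewrite IH vset_mul //; apply: eq_vset => P _; rewrite mulrS.
Qed.

Lemma prime_atE P : S P -> prime_at O P = vset S (single P 1).
Proof.
move=> PS; apply/seteqP; split => [x [xO xP] Q QS|x xP].
  rewrite /single; case: eqP => [->|_]; last exact: xO.
  have [->|x0] := eqVneq x 0; first exact: vge0.
  by rewrite vgeE //; move: xP; rewrite /= valE // lte_fin.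
split => [Q QS|].
  by apply: vgeW (xP Q QS); rewrite /single; case: ifP.
have := xP P PS; rewrite /single eqxx; have [->|x0] := eqVneq x 0.
  by rewrite /= val0.
by rewrite vgeE //= valE // lte_fin.
Qed.

Lemma ideal_expE P (m : int) : S P -> ideal_exp O (prime_at O P) m = vset S (single P m).
Proof.
move=> PS; rewrite prime_atE //; have fs := finsupp_single P 1.
have fsN : finsupp_on (fun Q => - single P 1 Q).
  by have [T TP] := fs; exists T => Q QS QT; rewrite TP // oppr0.
case: m => n; rewrite /ideal_exp.
  rewrite vset_iter //; apply: eq_vset => Q _.
  by rewrite /single; case: eqP; rewrite ?mul0rn // -natz.
rewrite vset_inv // vset_iter //; apply: eq_vset => Q _.
by rewrite /single; case: eqP; rewrite ?oppr0 ?mul0rn // NegzE mulNrn -natz.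
Qed.

(** For m > 0 the element 1 of O is missing on the left; the case m < 0 reduces to
    this one by inversion. *)
Lemma vset_single_eq0 P m : S P -> vset S (single P m) = O -> m = 0.
Proof.
have one b : (forall P, b P = 0) -> vset S b 1.
  by move=> b0 Q QS; rewrite b0 vgeE ?oner_eq0 // vint1.
have nonpos n : S P -> vset S (single P n) = O -> n <= 0.
  move=> PS nO; have : vset S (single P n) 1 by rewrite nO; exact: one.
  by move=> /(_ P PS); rewrite /single eqxx vgeE ?oner_eq0 // vint1.
move=> PS mO; apply/eqP; rewrite eq_le nonpos //= -oppr_le0; apply: nonpos => //.
have sub0 : O = ideal_mul (vset S (single P m)) (vset S (single P (- m))).
  rewrite vset_mul; last exact: finsupp_single.
  by apply: eq_vset => Q _; rewrite /single; case: eqP; rewrite ?subrr ?addr0.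
rewrite [RHS]sub0 mO vset_mul; last by exists [::].
by apply: eq_vset => Q _; rewrite add0r.
Qed.

Lemma prod_single (s : seq (place F)) (g : place F -> int) : uniq s ->
  (forall P, P \in s -> S P) ->
  \big[@ideal_mul k F/O]_(P <- s) vset S (single P (g P)) =
    vset S (fun Q => if Q \in s then g Q else 0).
Proof.
elim: s => [|P s IH] /=; first by rewrite big_nil.
move=> /andP[Ps us] sS; rewrite big_cons IH //; last first.
  by move=> Q Qs; apply: sS; rewrite inE Qs orbT.
rewrite vset_mul; last exact: finsupp_single.
apply: eq_vset => Q _; rewrite /single inE; case: eqP => [->|_] /=.
  by rewrite (negPf Ps) addr0.
by rewrite add0r.
Qed.

(** By [vset_mul] the exponents of the prime powers add up. The product leaves out
    the factors equal to O; their exponents are 0 by [vset_single_eq0]. *)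
Lemma ideal_ofE D : divisor D -> ideal_of O S D = vset S (fun P => - D P).
Proof.
move=> divD; rewrite /ideal_of.
set G := fun P => ideal_exp O (prime_at O P) (- D P).
have supp : S `&` G @^-1` [set~ O] `<=` [set P | D P != 0].
  move=> P [PS] /=; rewrite /G ideal_expE // => nO.
  apply/eqP => D0; apply: nO; rewrite D0 oppr0; apply: eq_vset => Q _.
  by rewrite /single; case: ifP.
have fin := sub_finite_set supp divD.
have mem := in_finite_support fin.
rewrite (eq_big_seq (fun P => vset S (single P (- D P)))); last first.
  by move=> P; rewrite mem inE => -[PS _]; rewrite ideal_expE.
rewrite prod_single ?finite_support_uniq //; last first.
  by move=> P; rewrite mem inE => -[].
apply: eq_vset => P PS; case: ifPn => //; rewrite mem => /negP Pn.
apply/esym; apply: (vset_single_eq0 PS); apply: contrapT => nO; apply: Pn.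
by rewrite inE; split => //=; rewrite /G ideal_expE.
Qed.

End IdealsAsValuationSets.

(** * Finite dimension of spaces with bounded poles *)

Section FiniteDimension.
Variables (k : fieldType) (F : fieldExtType (ratfun k)).
Implicit Types (P Q : place F) (x y z : F) (a b f g p : {poly k}).

Local Notation t := (pol F 'X).
Local Notation fin_places := (@finite_places k F).
Local Notation inf_places := (@infinite_places k F).

Let t0 : t != 0. Proof. by rewrite pol_eq0 polyX_eq0. Qed.

Definition kconst (c : k) : F := pol F c%:P.

Lemma kconstN c : kconst (- c) = - kconst c.
Proof. by rewrite /kconst polyCN rmorphN. Qed.

Lemma kconstM c d : kconst (c * d) = kconst c * kconst d.
Proof. by rewrite /kconst polyCM rmorphM. Qed.

Lemma kconst0 : kconst 0 = 0. Proof. by rewrite /kconst polyC0 rmorph0. Qed.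

Lemma kconst1 : kconst 1 = 1. Proof. by rewrite /kconst polyC1 rmorph1. Qed.

Lemma kconst_eq0 c : (kconst c == 0) = (c == 0).
Proof. by rewrite /kconst pol_eq0 polyC_eq0. Qed.

(** The quotient of L by M has dimension less than the cardinal of I. The index type
    is arbitrary so that index types can be multiplied for towers of spaces. *)
Definition dependent_mod (I : finType) (L M : set F) := forall y : I -> F,
  (forall i, L (y i)) ->
  exists c : I -> k, (exists i, c i != 0) /\ M (\sum_i kconst (c i) * y i).

(** Relations modulo M within each block of the family give a family in M. *)
Lemma dependent_mod_trans (I J : finType) (L M N : set F) :
  dependent_mod I L M -> dependent_mod J M N -> dependent_mod (J * I)%type L N.
Proof.
move=> LM MN y yL.
have /choice[c cP] : forall j, exists c : I -> k, (exists i, c i != 0) /\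
    M (\sum_i kconst (c i) * y (j, i)) by move=> j; exact: LM.
have [d [[j dj] dN]] := MN _ (fun j => (cP j).2).
have [i cji] := (cP j).1.
exists (fun u => d u.1 * c u.1 u.2); split.
  by exists (j, i) => /=; rewrite mulf_neq0.
rewrite (_ : \sum_i _ = \sum_j kconst (d j) * \sum_i kconst (c j i) * y (j, i)) //.
under [RHS]eq_bigr do rewrite mulr_sumr.
rewrite pair_bigA; apply: eq_bigr => -[j' i'] _ /=.
by rewrite kconstM mulrA.
Qed.

Definition ksubspace (L : set F) := [/\ L 0, forall x y, L x -> L y -> L (x + y)
  & forall c x, L x -> L (kconst c * x)].

(** A maximal k-independent family in L generates it; the size of independent
    families is bounded by the cardinal of I. *)
Lemma dependent_fin_gen (I : finType) (L : set F) : ksubspace L ->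
  dependent_mod I L [set 0] -> fin_gen consts L.
Proof.
move=> [L0 LD LZ] dep.
pose indep m (y : nat -> F) := forall c : nat -> k,
  \sum_(i < m) kconst (c i) * y i = 0 -> forall i, (i < m)%N -> c i = 0.
have : exists m, `[< forall y : nat -> F, (forall i, L (y i)) -> ~ indep m y >].
  exists #|I|; apply/asboolP => y yL yI.
  have [c [[i ci] c0]] := dep (fun i => y (enum_rank i)) (fun i => yL _).
  pose c' j := if insub j is Some j' then c (enum_val (j' : 'I_#|I|)) else 0.
  have c'E j : c' (enum_rank j) = c j.
    by rewrite /c' valK enum_rankK.
  case/eqP: ci; rewrite -c'E; apply: yI => //.
  rewrite -[RHS]c0 (reindex (@enum_rank I)) /=; last first.
    by apply: onW_bij; exact: enum_rank_bij.
  by apply: eq_bigr => j _; rewrite c'E.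
move=> /ex_minnP[[|m]].
  by move=> /asboolP max0 _; case: (max0 (fun=> 0) (fun=> L0)) => c _ i.
move=> /asboolP max min.
have [y yL yI] : exists2 y : nat -> F, (forall i, L (y i)) & indep m y.
  apply: contrapT => none; suff : (m.+1 <= m)%N by rewrite ltnn.
  by apply: min; apply/asboolP => y yL yI; apply: none; exists y.
exists (mkseq y m); apply/seteqP; split => x.
  move=> xL; pose y' i := if (i < m)%N then y i else x.
  have y'E (i : 'I_m) : y' i = y i by rewrite /y' ltn_ord.
  have y'L i : L (y' i) by rewrite /y'; case: ifP.
  have /existsNP[c /not_implyP[c0 /existsNP[i /not_implyP[im /eqP ci]]]] := max y' y'L.
  move: c0; rewrite big_ord_recr /= {2}/y' ltnn.
  under eq_bigr do rewrite y'E.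
  move=> c0; have cm : kconst (c m) != 0.
    rewrite kconst_eq0; apply: contraNneq ci => cm.
    move: im; rewrite ltnS leq_eqVlt => /predU1P[->|im]; first exact/eqP.
    by apply/eqP; apply: yI im; rewrite -[RHS]c0 cm kconst0 mul0r addr0.
  exists (fun i => tofrac (- (c m)^-1 * c i)%:P); split.
    by move=> j; exists (- (c m)^-1 * c j).
  rewrite size_mkseq; apply: (mulfI cm).
  rewrite -[LHS](addKr (\sum_(i < m) kconst (c i) * y i)) c0 addr0.
  rewrite mulr_sumr -sumrN; apply: eq_bigr => j _; rewrite nth_mkseq //.
  rewrite -[_ *: _]mulr_algl -/(pol F _) -/(kconst _) kconstM kconstN mulNr mulNr mulrN.
  rewrite !mulrA -kconstM mulfV ?kconst1 ?mul1r //.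
  by rewrite -kconst_eq0.
move=> [c [cS ->]]; rewrite size_mkseq; apply: big_ind => // i _.
have [d ->] := cS i; rewrite nth_mkseq // -mulr_algl; exact: LZ.
Qed.

(** Euclidean division of the numerator by the denominator. *)
Lemma polynomial_part (c : ratfun k) : exists q (r : F), (c%:A : F) = pol F q + r /\
  forall P, inf_places P -> vge P (ram_index P)%:Z r.
Proof.
have [a [b [b0 cE]]] := alg_frac F c.
have pb0 : pol F b != 0 by rewrite pol_eq0.
exists (a %/ b), (pol F (a %% b) / pol F b); split.
  by rewrite cE {1}(divp_eq a b) rmorphD rmorphM mulrDl mulfK.
move=> P Pinf; have [->|r0] := eqVneq (a %% b) 0.
  by rewrite rmorph0 mul0r; exact: vge0.
have [Pt vt] := ((infinite_placesP P).1 Pinf, vint_t_inf Pinf).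
have pr0 : pol F (a %% b) != 0 by rewrite pol_eq0.
rewrite vgeE ?mulf_neq0 ?invr_eq0 // vintM ?invr_eq0 // vintV //.
rewrite (vint_pol_inf Pt r0) (vint_pol_inf Pt b0) vt.
have rb : (size (a %% b)%R < size b)%N by rewrite ltn_modp.
have : (0 < size (a %% b)%R)%N by rewrite size_poly_gt0.
move: rb; move: (size _) (size _) (ram_index P) => u v e; nia.
Qed.

(** The polynomial part has no pole at P either, so it is constant. *)
Lemma polynomial_part_const (c : ratfun k) P : inf_places P -> vge P 0 c%:A ->
  exists (d : k) (r : F), (c%:A : F) = kconst d + r /\
  forall P, inf_places P -> vge P (ram_index P)%:Z r.
Proof.
move=> Pinf Pc; have [q [r [cE rP]]] := polynomial_part c.
exists q`_0, r; split => //; rewrite cE /kconst -size1_polyC //.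
have [->|q0] := eqVneq q 0; first by rewrite size_poly0.
have pq0 : pol F q != 0 by rewrite pol_eq0.
have : vge P 0 (pol F q).
  rewrite -[pol F q](addrK r) -cE; apply: vgeB => //.
  by apply: vgeW (rP P Pinf).
have Pt := (infinite_placesP P).1 Pinf.
rewrite vgeE // (vint_pol_inf Pt q0).
by move: (size q) Pt => u; nia.
Qed.

(** The Riemann-Roch space of m (t)_infty. *)
Definition bounded_poles (m : int) : set F := [set x |
  vset fin_places (fun=> 0) x /\
  vset inf_places (fun P => - (m * (ram_index P)%:Z)) x].

(** Among [F : k(t)] + 1 elements there is a relation over k(t), which can be
    scaled to have coefficients finite at infinity, one of them being 1; their
    values at infinity are the coefficients sought. *)
Lemma bounded_poles_step m :
  dependent_mod 'I_(\dim {:F}).+1 (bounded_poles m) (bounded_poles (m - 1)).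
Proof.
move=> y yL; have [P0 P0inf] := infinite_place_exists F.
have [c [cP0 [i ci] sum0]] := scaled_linear_dependence P0 y (leqnn _).
have /choice[d /choice[r dr]] : forall j, exists (d : k) (r : F),
    ((c j)%:A : F) = kconst d + r /\
    forall P, inf_places P -> vge P (ram_index P)%:Z r.
  by move=> j; exact: polynomial_part_const P0inf (cP0 j).
exists d; split.
  exists i; apply/eqP => di; have [+ ri] := dr i.
  rewrite ci di kconst0 add0r => r1.
  have := ri P0 P0inf; rewrite -r1 vgeE ?oner_eq0 // vint1.
  by have [e _] := ram_indexP P0inf; lia.
split => P PS.
  apply: vge_sum => j _; apply: vge0M; first exact: vge_const.
  by case: (yL j) => /(_ P PS).
have -> : \sum_j kconst (d j) * y j = - \sum_j r j * y j.
  apply/eqP; rewrite -addr_eq0 -big_split /= -[X in _ == X]sum0; apply/eqP.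
  by apply: eq_bigr => j _; rewrite (dr j).1 mulrDl.
apply: vgeN; apply: vge_sum => j _.
have -> : - ((m - 1) * (ram_index P)%:Z) = (ram_index P)%:Z + - (m * (ram_index P)%:Z).
  by rewrite mulrBl mul1r opprB.
by apply: vgeM; [exact: (dr j).2 | case: (yL j) => _ /(_ P PS)].
Qed.

(** Induction from [bounded_poles (-1)], whose elements have no poles and vanish at
    infinity, so that they are 0. *)
Lemma bounded_poles_dependent (m : nat) : exists I : finType,
  dependent_mod I (bounded_poles (m%:Z - 1)) [set 0].
Proof.
elim: m => [|m [J IH]].
  exists 'I_1 => y yL; exists (fun=> 1); split; first by exists ord0; rewrite oner_neq0.
  rewrite /= big_ord1 kconst1 mul1r.
  have [yfin yinf] := yL ord0; have [P0 P0inf] := infinite_place_exists F.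
  have inf P : inf_places P -> vge P 1 (y ord0).
    move=> Pinf; have := yinf P Pinf; have [e _] := ram_indexP Pinf.
    by apply: vgeW; lia.
  apply: (no_poles_eq0 (P0 := P0)); last exact: inf.
  move=> P; have [/inf|nP] := pselect (inf_places P); first exact: vgeW.
  exact: yfin.
exists (J * 'I_(\dim {:F}).+1)%type; apply: dependent_mod_trans IH.
have := @bounded_poles_step (m.+1%:Z - 1).
by have -> : m.+1%:Z - 1 - 1 = m%:Z - 1 by lia.
Qed.

(** A product of powers of polynomials, each vanishing at one of the finitely many
    places in the support of D. *)
Lemma divisor_polynomial (D : place F -> int) : divisor D ->
  exists2 f, f != 0 & forall P, fin_places P -> D P <= vint P (pol F f).
Proof.
move=> divD.
have /choice[h hP] : forall P, exists h, h != 0 /\ (fin_places P -> D P <= vint P (pol F h)).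
  move=> P; have [Pfin|nfin] := pselect (fin_places P); last by exists 1; rewrite oner_neq0.
  have [h h0 hP] := finite_place_poly Pfin; exists (h ^+ `|D P|); split => [|_].
    by rewrite expf_neq0.
  have ph0 : pol F h != 0 by rewrite pol_eq0.
  rewrite rmorphXn vintX //; move: hP; rewrite vgeE //.
  move: (vint P _) (D P) => v d v_gt0.
  have : 0 <= (v - 1) * `|d|%N%:Z by rewrite mulr_ge0 // subr_ge0.
  lia.
exists (\prod_(P <- finmap.enum_fset (fset_set [set P | D P != 0])) h P).
  by rewrite prodf_seq_neq0; apply/allP => P _; case: (hP P).
move=> P Pfin; have memD := in_fset_set divD.
set T := finmap.enum_fset _.
have pr0 (s : seq (place F)) : pol F (\prod_(Q <- s) h Q) != 0.
  by rewrite pol_eq0 prodf_seq_neq0; apply/allP => Q _; case: (hP Q).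
have [PT|PT] := boolP (P \in T); last first.
  have -> : D P = 0.
    apply: contrapT => /eqP DP; case/negP: PT; rewrite [_ \in _]memD.
    by rewrite inE.
  by rewrite -(vgeE _ _ (pr0 T)); exact: vge_pol_fin.
rewrite (big_rem P) //= rmorphM vintM ?pr0 ?pol_eq0 ?(hP P).1 //.
rewrite -[D P]addr0; apply: lerD; first exact: (hP P).2.
by rewrite -(vgeE _ _ (pr0 _)); exact: vge_pol_fin.
Qed.

(** Multiplication by a polynomial with sufficiently high zeros at the finite poles
    allowed by D embeds L into some [bounded_poles m]. *)
Lemma bounded_dependent (D : place F -> int) (m : nat) (L : set F) : divisor D ->
  L `<=` vset fin_places (fun P => - D P) ->
  L `<=` vset inf_places (fun P => - (m%:Z * (ram_index P)%:Z)) ->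
  exists I : finType, dependent_mod I L [set 0].
Proof.
move=> divD Lfin Linf; have [f f0 fD] := divisor_polynomial divD.
have pf0 : pol F f != 0 by rewrite pol_eq0.
have [I dep] := bounded_poles_dependent (m + (size f).-1).+1.
exists I => y yL.
have [|c [ci c0]] := dep (fun i => pol F f * y i).
  move=> i; split => P PS.
    apply: (@vgeW _ _ _ _ (D P + - D P)); first by rewrite subrr.
    by apply: vgeM; [rewrite vgeE //; exact: fD | exact: Lfin (yL i) P PS].
  apply: (@vgeW _ _ _ _ (vint P (pol F f) + - (m%:Z * (ram_index P)%:Z))); last first.
    by apply: vgeM; [exact: vge_vint | exact: Linf (yL i) P PS].
  rewrite (vint_pol_inf ((infinite_placesP P).1 PS) f0) (vint_t_inf PS).
  by move: (_.-1) => n; lia.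
exists c; split => //; move: c0; rewrite /=.
under eq_bigr do rewrite mulrCA.
by rewrite -mulr_sumr => /eqP; rewrite mulf_eq0 (negPf pf0) => /eqP.
Qed.

End FiniteDimension.

(** * The norm of a divisor *)

Section Norm.
Variables (R : realType) (k : fieldType) (F : fieldExtType (ratfun k)).
Variable D : place F -> int.
Implicit Types (P Q : place F) (x y z : F) (m : \bar R).

Local Notation t := (pol F 'X).
Local Notation fin_places := (@finite_places k F).
Local Notation inf_places := (@infinite_places k F).
Local Notation N := (@div_norm k F R D).

Let normalised P x : \bar R :=
  ((ext_intr R (P x) + (D P)%:~R%:E) * ((ram_index P)%:R^-1)%:E)%E.

Let ram_gt0 P : inf_places P -> 0 < (ram_index P)%:R :> R.
Proof. by move=> /ram_indexP[e _]; rewrite ltr0n. Qed.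

Let normalised0 P : inf_places P -> normalised P 0 = +oo%E.
Proof.
by move=> Pinf; rewrite /normalised val0 /= gt0_mulye // lte_fin invr_gt0 ram_gt0.
Qed.

Let normalisedE P x : x != 0 ->
  normalised P x = ((vint P x + D P)%:~R / (ram_index P)%:R)%:E.
Proof. by move=> x0; rewrite /normalised valE //= -EFinD -intrD -EFinM. Qed.

(** The terms that the operator leaves out are +oo, which satisfies every lower
    bound. *)
Lemma bigmin_ge (A : set (place F)) (f : place F -> \bar R) m : finite_set A ->
  (m <= \big[Order.min/+oo]_(P \in A) f P)%E <-> forall P, A P -> (m <= f P)%E.
Proof.
move=> finA; have seqP (s : seq (place F)) :
    (m <= \big[Order.min/+oo]_(P <- s) f P)%E <-> forall P, P \in s -> (m <= f P)%E.
  elim: s => [|P s IH]; first by rewrite big_nil leey.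
  rewrite big_cons le_min; split => [/andP[mP ms] Q|ms].
    by rewrite inE => /predU1P[->//|]; exact: IH.1.
  by rewrite ms ?mem_head //=; apply/IH => Q Qs; apply: ms; rewrite inE Qs orbT.
have fin : finite_set (A `&` f @^-1` [set~ +oo%E]) by apply: sub_finite_set finA => P [].
rewrite (propext (seqP _)); split => mf P PA; last first.
  by apply: mf; move: PA; rewrite (in_finite_support fin) inE => -[].
have [->|fP] := eqVneq (f P) +oo%E; first by rewrite leey.
by apply: mf; rewrite (in_finite_support fin) inE; split => //; exact/eqP.
Qed.

(** The norm is handled through its upper bounds, which unlike the minimum itself
    are conditions on each place separately. *)
Lemma div_norm_le x m :
  (N x <= m)%E <-> forall P, inf_places P -> (- m <= normalised P x)%E.
Proof. by rewrite /div_norm leeNl bigmin_ge //; exact: finite_infinite_places. Qed.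

Lemma div_norm_le_fin x (r : R) : (N x <= r%:E)%E <-> forall P, inf_places P ->
  x = 0 \/ - r * (ram_index P)%:R <= (vint P x + D P)%:~R.
Proof.
rewrite div_norm_le; split => xr P Pinf.
  have [->|x0] := eqVneq x 0; [by left | right].
  by have := xr P Pinf; rewrite normalisedE // lee_fin ler_pdivlMr // ram_gt0.
have [->|x0] := eqVneq x 0; first by rewrite normalised0 // leey.
rewrite normalisedE // lee_fin ler_pdivlMr ?ram_gt0 //.
by case: (xr P Pinf) x0 => // ->; rewrite eqxx.
Qed.

Lemma div_norm_le_int x (r : int) : (N x <= r%:~R%:E)%E <->
  vset inf_places (fun P => - D P - r * (ram_index P)%:Z) x.
Proof.
rewrite div_norm_le_fin; split => xr P Pinf; have := xr P Pinf.
  move=> [->|]; first exact: vge0.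
  have [->|x0] := eqVneq x 0; first by move=> _; exact: vge0.
  rewrite pmulrn -intrN -intrM ler_int vgeE //; lia.
have [->|x0] := eqVneq x 0; first by left.
by rewrite vgeE // => xP; right; rewrite pmulrn -intrN -intrM ler_int; lia.
Qed.

Lemma rdeg_vint (c : ratfun k) : (c%:A : F) != 0 -> exists d : int,
  rdeg c = d%:E /\ forall P, inf_places P -> vint P c%:A = - ((ram_index P)%:Z * d).
Proof.
move=> cF0; have c0 : c != 0 by rewrite -(alg_eq0 F).
have [a [b [a0 b0 cE]]] := ratfun_frac c0; clear c0.
have cd := rdeg_frac a0 b0 cE.
exists ((size a)%:Z - (size b)%:Z); split => // P /ram_indexP[_ /(_ c)].
by rewrite cd valE // -EFinN -EFinM => -[->]; rewrite mulrN.
Qed.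

Lemma div_norm_lt_pinfty x : N x <> +oo%E.
Proof.
suff [r xr] : exists r : int, (N x <= r%:~R%:E)%E by move=> Nx; rewrite Nx in xr.
pose T := finmap.enum_fset (fset_set inf_places).
exists (\sum_(P <- T) (`|vint P x| + `|D P|))%N%:Z; apply/div_norm_le_int => P Pinf.
have PT : P \in T by rewrite [_ \in _](in_fset_set (finite_infinite_places F)) inE.
have [e _] := ram_indexP Pinf.
apply: vgeW (vge_vint P x); rewrite (big_rem P) //=.
by move: (\sum_(_ <- _) _)%N => s; nia.
Qed.

Lemma div_norm_is_norm : is_norm setT setT N.
Proof.
have [P0 P0inf] := infinite_place_exists F.
split.
- by move=> x _; exact: div_norm_lt_pinfty.
- move=> x y _ _; apply/div_norm_le => P Pinf.
  have mono z w : (P z <= P w)%E -> (normalised P z <= normalised P w)%E.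
    have [->|w0] := eqVneq w 0; first by rewrite normalised0 // leey.
    have [->|z0] := eqVneq z 0; first by rewrite val0 valE.
    rewrite !valE // !normalisedE // !lee_fin => zw.
    by rewrite ler_pM2r ?invr_gt0 ?ram_gt0 // ler_int lerD2r.
  have /div_norm_le/(_ P Pinf) xm : (N x <= Order.max (N x) (N y))%E by rewrite le_max lexx.
  have /div_norm_le/(_ P Pinf) ym : (N y <= Order.max (N x) (N y))%E by rewrite le_max lexx orbT.
  have [_ _ /(_ x y) + _ _] := val_atP P; rewrite ge_min => /orP[] /mono; exact: le_trans.
- move=> a x _ _; have [aF0|aF0] := eqVneq (a%:A : F) 0.
    have a0 : a = 0 by apply/eqP; rewrite -(alg_eq0 F) aF0.
    rewrite a0 scale0r rdeg0 /=; apply/eqP; rewrite -leeNy_eq; apply/div_norm_le => P Pinf.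
    by rewrite normalised0 // leey.
  have [d [-> ad]] := rdeg_vint aF0.
  have shift P : inf_places P -> normalised P (a *: x) = (normalised P x - d%:~R%:E)%E.
    move=> Pinf; rewrite -mulr_algl; have [->|x0] := eqVneq x 0.
      by rewrite mulr0 normalised0.
    rewrite !normalisedE ?mulf_neq0 // vintM // (ad P Pinf) -EFinN -EFinD.
    congr (_%:E); apply: (mulIf (lt0r_neq0 (ram_gt0 Pinf))).
    rewrite mulrBl !mulfVK ?(lt0r_neq0 (ram_gt0 Pinf)) //.
    by rewrite pmulrn -intrM -intrB; congr (_%:~R); ring.
  have le m : (N (a *: x) <= m)%E <-> (d%:~R%:E + N x <= m)%E.
    rewrite addeC -leeBrDr // !div_norm_le.
    by split => am P Pinf; have := am P Pinf; rewrite shift // leeBrDr // fin_num_oppeB.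
  by apply/eqP; rewrite eq_le; apply/andP; split; [apply/le | apply/le].
- move=> x _; split => [xN|->].
    have [//|x0] := eqVneq x 0.
    have : (N x <= -oo)%E by rewrite xN.
    by move=> /div_norm_le/(_ P0 P0inf); rewrite normalisedE.
  apply/eqP; rewrite -leeNy_eq; apply/div_norm_le => P Pinf.
  by rewrite normalised0 // leey.
Qed.

End Norm.

(** * The lattice of a divisor *)

Section RiemannRochLattice.
Variables (R : realType) (k : fieldType) (F : fieldExtType (ratfun k)).
Variables (D : place F -> int) (divD : divisor D).
Implicit Types (P Q : place F) (x y z : F).

Local Notation t := (pol F 'X).
Local Notation fin_places := (@finite_places k F).
Local Notation inf_places := (@infinite_places k F).
Local Notation N := (@div_norm k F R D).

Lemma fin_idealE : fin_ideal D = vset fin_places (fun P => - D P).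
Proof.
rewrite /fin_ideal int_closure_polys ideal_ofE //.
exact: strong_approximation_fin.
Qed.

Lemma inf_idealE : inf_ideal D = vset inf_places (fun P => - D P).
Proof.
rewrite /inf_ideal int_closure_A_infty ideal_ofE //.
exact: strong_approximation_inf.
Qed.

Lemma shift_inf_idealE (r : int) : [set t_elt F ^ r * x | x in inf_ideal D] =
  vset inf_places (fun P => - D P - r * (ram_index P)%:Z).
Proof.
rewrite inf_idealE; have t0 : t != 0 by rewrite pol_eq0 polyX_eq0.
have vt P (m : int) : inf_places P -> vge P (- (m * (ram_index P)%:Z)) (t ^ m).
  by move=> Pinf; rewrite vgeE ?expfz_neq0 // vintXz // vint_t_inf //; lia.
apply/seteqP; split => [_ [x xP <-] P Pinf|x xP].
  by rewrite addrC; apply: vgeM; [exact: vt | exact: xP].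
exists (t ^ (- r) * x); last first.
  by rewrite mulrA -[t_elt F]/t -expfzDr // subrr mul1r.
move=> P Pinf; have := vgeM (vt P (- r) Pinf) (xP P Pinf).
by apply: vgeW; lia.
Qed.

Lemma RRspaceE (r : int) : RRspace (fun P => D P + r * t_infty P) =
  vset fin_places (fun P => - D P) `&`
  vset inf_places (fun P => - D P - r * (ram_index P)%:Z).
Proof.
apply/seteqP; split => x.
  move=> xRR; have {}xRR P : vge P (- (D P + r * t_infty P)) x.
    by case: xRR => [->|]; [exact: vge0 | exact].
  split => P PS; have := xRR P; rewrite /t_infty; case: ifPn => Pinf.
  - by case: PS; move: Pinf; rewrite inE.
  - by rewrite mulr0 addr0.
  - by rewrite opprD.
  - by case/negP: Pinf; rewrite inE.
move=> [xfin xinf]; right => P; rewrite /t_infty; case: ifPn => [|/negP] Pinf.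
  by rewrite opprD; apply: xinf; move: Pinf; rewrite inE.
by rewrite mulr0 addr0; apply: xfin => Pinf'; apply: Pinf; rewrite inE.
Qed.

Lemma vset_ksubspace S (a : place F -> int) : ksubspace (vset S a).
Proof.
split => [P _|x y xS yS P PS|c x xS P PS]; first exact: vge0.
  by apply: vgeD; [exact: xS | exact: yS].
by rewrite -[a P]add0r; apply: vgeM; [exact: vge_const | exact: xS].
Qed.

Lemma ksubspaceI (L M : set F) : ksubspace L -> ksubspace M -> ksubspace (L `&` M).
Proof.
move=> [L0 LD LZ] [M0 MD MZ]; split => // [x y [? ?] [? ?]|c x [? ?]].
  by split; [exact: LD | exact: MD].
by split; [exact: LZ | exact: MZ].
Qed.

Lemma bounded_fin_gen (m : int) : fin_gen consts
  (vset fin_places (fun P => - D P) `&`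
   vset inf_places (fun P => - (m * (ram_index P)%:Z))).
Proof.
have [||J dep] := @bounded_dependent _ F D `|m|%N (vset fin_places (fun P => - D P) `&`
   vset inf_places (fun P => - (m * (ram_index P)%:Z))) divD.
- by move=> x [].
- by move=> x [_ xinf] P Pinf; apply: vgeW (xinf P Pinf); nia.
- apply: dependent_fin_gen dep; apply: ksubspaceI; exact: vset_ksubspace.
Qed.

(** A bound r on the norm bounds the pole orders at infinity; it is rounded up to
    the integer m, the values of D being absorbed. *)
Lemma le_part_fin_gen (r : R) : fin_gen consts (le_part (fin_ideal D) N r).
Proof.
have [_ ND NZ /(_ 0 I)[_ /(_ erefl) N0]] := div_norm_is_norm R D.
pose T := finmap.enum_fset (fset_set inf_places).
pose m := (Num.bound r + \sum_(P <- T) `|D P|)%N.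
have [||J dep] := @bounded_dependent _ F D m (le_part (fin_ideal D) N r) divD.
- by move=> x [+ _]; rewrite fin_idealE.
- move=> x [_ /div_norm_le_fin xr] P Pinf.
  have [->|x0] := eqVneq x 0; first exact: vge0.
  have PT : P \in T by rewrite [_ \in _](in_fset_set (finite_infinite_places F)) inE.
  have Dm : (`|D P|%N + Num.bound r <= m)%N by rewrite /m (big_rem P) //=; lia.
  have [e _] := ram_indexP Pinf.
  case: (xr P Pinf) => [/eqP|]; first by rewrite (negPf x0).
  have rb : r <= (Num.bound r)%:R by apply: ltW; exact: unstable.ltr_bound.
  move=> le; have : - (Num.bound r)%:R * (ram_index P)%:R <= (vint P x + D P)%:~R :> R.
    by apply: le_trans le; rewrite ler_pM2r ?ltr0n // lerN2.
  rewrite !pmulrn -intrN -intrM ler_int vgeE //.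
  by move: Dm e; move: (Num.bound r) (ram_index P) (vint P x) (D P) => *; nia.
- apply: dependent_fin_gen dep; split.
  + split; first by rewrite fin_idealE => P _; exact: vge0.
    by rewrite N0 leNye.
  + move=> x y [xI xr] [yI yr]; split.
      move: xI yI; rewrite fin_idealE.
      by case: (vset_ksubspace fin_places (fun P => - D P)) => _ + _; exact.
    by rewrite (le_trans (ND x y I I)) // ge_max xr yr.
  + move=> c x [xI xr]; split.
      move: xI; rewrite fin_idealE.
      by case: (vset_ksubspace fin_places (fun P => - D P)) => _ _; exact.
    have [->|c0] := eqVneq c 0.
      by rewrite kconst0 mul0r N0 leNye.
    rewrite /kconst /pol mulr_algl NZ // (@rdeg_frac _ _ c%:P 1) ?polyC_eq0 ?oner_eq0 //.
      by rewrite size_polyC c0 size_poly1 subrr add0e.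
    by rewrite tofrac1 mulr1.
Qed.

(** Any basis, multiplied by a polynomial that clears finite poles. *)
Lemma full_rank_fin_ideal : exists b : (\dim {:F}).-tuple F,
  basis_of {:F} b /\ forall x, x \in b -> vset fin_places (fun P => - D P) x.
Proof.
have [f f0 fD] : exists2 f, f != 0 & forall P, fin_places P -> - D P <= vint P (pol F f).
  apply: divisor_polynomial; apply: sub_finite_set divD => P /=.
  by rewrite oppr_eq0.
have pf0 : pol F f != 0 by rewrite pol_eq0.
pose e := vbasis {:F}.
have /choice[h hP] : forall x, exists h, h != 0 /\ vset fin_places (fun=> 0) (pol F h * x).
  by move=> x; have [h h0 hP] := denominator x; exists h.
pose d := f * \prod_(x <- e) h x.
have d0 : pol F d != 0.
  rewrite pol_eq0 mulf_neq0 // prodf_seq_neq0; apply/allP => x _.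
  by case: (hP x).
exists (map_tuple (fun x => pol F d * x) e); split.
  rewrite basisEdim size_tuple leqnn andbT.
  have eF : ({:F} <= <<e>>)%VS by rewrite (span_basis (vbasisP {:F})).
  apply: subv_trans eF _; apply/span_subvP => x xe.
  have -> : x = (tofrac d)^-1 *: (pol F d * x).
    by rewrite -[RHS]mulr_algl algV mulKf.
  apply: memvZ; apply: memv_span; exact: map_f.
move=> _ /mapP[x xe ->] P Pfin; rewrite /d rmorphM -mulrA.
rewrite -[- D P]addr0; apply: vgeM; first by rewrite vgeE //; exact: fD.
rewrite (big_rem x) //= rmorphM mulrAC; apply: vge0M; last exact: vge_pol_fin.
by case: (hP x) => _; exact.
Qed.

(** Modulo the polynomial combinations of a basis of F contained in I, an
    element of I is bounded at infinity; the elements of I with a given bound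
    at infinity have finite dimension over k. *)
Lemma fin_ideal_fin_gen : fin_gen polys (fin_ideal D).
Proof.
rewrite fin_idealE; set A := vset _ _.
have [b [bbasis bA]] := full_rank_fin_ideal.
pose T := finmap.enum_fset (fset_set inf_places).
pose m := (\sum_(P <- T) \sum_(x <- b) `|vint P x|)%N.
have bm x P : x \in b -> inf_places P -> (`|vint P x| <= m)%N.
  move=> xb Pinf.
  have PT : P \in T by rewrite [_ \in _](in_fset_set (finite_infinite_places F)) inE.
  rewrite /m (big_rem P) //= (big_rem x) //=; lia.
have [s sE] := bounded_fin_gen m%:Z.
have sA i : (i < size s)%N -> A s`_i.
  move=> lti; have : span_over consts s s`_i.
    exists (fun j => if j == i then 1 else 0); split.
      move=> j; case: eqP => _.
        by exists 1; rewrite polyC1 tofrac1.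
      by exists 0; rewrite polyC0 tofrac0.
    rewrite (bigD1 (Ordinal lti)) //= eqxx scale1r big1 ?addr0 // => j.
    by rewrite -val_eqE /= => /negPf ->; rewrite scale0r.
  by rewrite -sE => -[].
exists s; apply/seteqP; split => x.
  move=> xA.
  have bs y : y \in b -> span_over consts s y.
    move=> yb; rewrite -sE; split; first exact: bA.
    move=> P Pinf; apply: vgeW (vge_vint P y).
    by have := bm y P yb Pinf; have [e _] := ram_indexP Pinf; nia.
  pose c i := coord b i x.
  have xE : x = \sum_i c i *: b`_i.
    by apply: coord_span; rewrite (span_basis bbasis) memvf.
  have /choice[q /choice[r qr]] : forall i, exists q (r : F), ((c i)%:A : F) = pol F q + r /\
      forall P, inf_places P -> vge P (ram_index P)%:Z r.
    by move=> i; exact: polynomial_part.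
  have bi (i : 'I_(\dim {:F})) : b`_i \in b by rewrite mem_nth // size_tuple.
  pose z := \sum_i r i * b`_i.
  have xqz : x = \sum_i pol F (q i) * b`_i + z.
    rewrite {1}xE -big_split /=; apply: eq_bigr => i _.
    by rewrite -mulr_algl (qr i).1 mulrDl.
  have zs : span_over consts s z.
    rewrite -sE; split => P PS.
      have -> : z = x - \sum_i pol F (q i) * b`_i by rewrite {1}xqz addrC addKr.
      apply: vgeB; first exact: xA.
      apply: vge_sum => i _; rewrite -[- D P]add0r.
      by apply: vgeM; [exact: vge_pol_fin | exact: bA (bi i) P PS].
    apply: vge_sum => i _; apply: (@vgeW _ _ _ _ ((ram_index P)%:Z + vint P b`_i)).
      by have := bm _ P (bi i) PS; have [e _] := ram_indexP PS; nia.
    by apply: vgeM; [exact: (qr i).2 | exact: vge_vint].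
  have [cz [czk zE]] := zs.
  have /choice[g gP] : forall i : 'I_(\dim {:F}), exists g : nat -> ratfun k,
     (forall j, consts (g j)) /\ b`_i = \sum_(j < size s) g j *: s`_j.
    by move=> i; exact: bs.
  exists (fun j => \sum_i tofrac (q i) * g i j + cz j); split.
    move=> j; have [w ->] := czk j.
    have /choice[v vP] : forall i, exists v : k, g i j = tofrac v%:P by move=> i; exact: (gP i).1.
    exists (\sum_i q i * (v i)%:P + w%:P); rewrite tofracD rmorph_sum; congr (_ + _).
    by apply: eq_bigr => i _; rewrite vP -tofracM.
  rewrite xqz zE.
  under [RHS]eq_bigr do rewrite scalerDl.
  rewrite big_split /=; congr (_ + _).
  under [RHS]eq_bigr do rewrite scaler_suml.
  rewrite exchange_big /=; apply: eq_bigr => i _.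
  rewrite {1}(gP i).2 mulr_sumr; apply: eq_bigr => j _.
  by rewrite /pol mulr_algl scalerA.
move=> [c [cP ->]] P Pfin; apply: vge_sum => i _.
have [a ->] := cP i; rewrite -mulr_algl -[- D P]add0r.
by apply: vgeM; [exact: vge_pol_fin | exact: sA (ltn_ord i) P Pfin].
Qed.

End RiemannRochLattice.

Theorem theorem3p1 (R : realType) (k : fieldType)
    (F : fieldExtType {fraction {poly k}}) (sepF : separable 1 {:F})
    (D : place F -> int) (divD : divisor D) (r : int) :
  (RRspace (fun P => D P + r * t_infty P)
     = fin_ideal D `&` [set t_elt F ^ r * x | x in inf_ideal D] /\
   fin_ideal D `&` [set t_elt F ^ r * x | x in inf_ideal D]
     = le_part (fin_ideal D) (@div_norm k F R D) r%:~R) /\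
  (lattice (fin_ideal D) (@div_norm k F R D) /\
   normed_space (@div_norm k F R D)).
Proof.
have norm := div_norm_is_norm R D.
have lat : lattice (fin_ideal D) (@div_norm k F R D).
  split; [exact: fin_ideal_fin_gen | | exact: le_part_fin_gen].
  by case: norm => [Ninf ND NZ N0]; split => [x _|x y _ _|a x _ _|x _];
    [exact: Ninf | exact: ND | exact: NZ | exact: N0].
split; last first.
  split => //; split => //; exists (fin_ideal D); split => //.
  have [b [bbasis bI]] := full_rank_fin_ideal divD.
  by exists b; split => // x /bI; rewrite fin_idealE.
rewrite RRspaceE shift_inf_idealE // fin_idealE //; split => //.
apply/seteqP; split => x [xfin xinf]; split.
- exact: xfin.
- by apply/div_norm_le_int.
- exact: xfin.
- by apply/(div_norm_le_int R).
Qed.
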